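(* Let $\Sigma$ be a closed, connected, oriented surface and let $D\subset\Sigma$ be a cellularly embedded, checkerboard colorable diagram of an oriented link in $\Sigma\times I$, with coloring $\xi$ and checkerboard surface $F_\xi$. Let $F'=F_\xi\#_\tau\Sigma$ (a spanning surface in the $S^*$-equivalence class of the dual checkerboard surface $F_{\xi^*}$). Then the signature, determinant, and nullity invariants of the Gordon-Litherland pairing $\mathcal G_{F'}$ are equal to those defined using the Goeritz matrix of the coloring $\xi$: $$\sigma(D,F')=\sigma_\xi(D),\qquad \det(D,F')={\textstyle\det_\xi}(D),\qquad n(D,F')=n_\xi(D).$$
   Context: $I=[0,1]$, $p\colon\Sigma\times I\to\Sigma$ is the projection. $D$ is cellularly embedded if $\Sigma\smallsetminus D$ is a union of open disks. A checkerboard coloring $\xi$ colors the components of $\Sigma\smallsetminus D$ black/white so that regions sharing an edge have different colors; $\xi^*$ interchanges the colors. The checkerboard surface $F_\xi\subset\Sigma\times I$ is the union of the black disks (in $\Sigma\times\{1/2\}$) and one half-twisted band per crossing; its boundary is the link. $F_\xi\#_\tau\Sigma$: the surface obtained by connecting $F_\xi$ by a small thin tube to a parallel copy of $\Sigma$ near $\Sigma\times\{0\}$, below $F_\xi$. Relative linking: for disjoint oriented $J,K\subset\Sigma\times I$, $\ell k_\Sigma(J,K)$ is the signed count of crossings where $J$ passes over $K$ (equivalently $J\cdot B$ for a 2-chain $B$ with $\partial B=K+c$, $c\subset\Sigma\times\{1\}$). Gordon-Litherland invariants: for a spanning surface $F$ (compact, $\partial F=L$), let $\widetilde F\to F$ be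 the $\{\pm1\}$-bundle associated to the $[-1,1]$-bundle given by a closed tubular neighborhood of $F$, and $\tau\colon H_1(F;\mathbb Z)\to H_1(\widetilde F;\mathbb Z)$ the transfer. $\mathcal G_F(\alpha,\beta)=\ell k_\Sigma(\tau\alpha,\beta)-p_*(\alpha)\cdot p_*(\beta)$ on $H_1(F;\mathbb Z)$. For $L$ oriented, let $L'$ be the push-off of $L$ missing $F$ (the parallel determined by the framing induced by $F$, oriented parallel to $L$) and $e(F,L)=-\ell k_\Sigma(L,L')$. For $F$ connected: $\sigma(L,F)=\operatorname{sig}(\mathcal G_F)+\tfrac12e(F,L)$, $\det(L,F)=|\det\mathcal G_F|$, $n(L,F)=\operatorname{nul}(\mathcal G_F)$; write $\sigma(D,F)$ etc. when $D$ is a diagram of $L$. Goeritz invariants: at a crossing $c$, the two strands are the edges of the half-twisted black band at $c$. The incidence number $\eta(c)=\pm1$ is the sign the crossing would have if both strands were oriented to run in the same direction along the band (so $\eta(c)=+1$ exactly for a right-handed half twist). With the given orientation of the link, $c$ is type II if the two strands run in the same direction along the black band, and type I if they run in opposite directions. Let $X_0,\dots,X_n$ be the white regions; for $i\ne j$ set $g_{ij}=-\sum\eta(c)$, summed over crossings incident to both $X_i$ and $X_j$, and $g_{ii}=-\sum_{k\neq i}g_{ik}$. The Goeritz matrix is $G_\xi(D)=(g_{ij})_{1\le i,j\le n}$. Let $\mu_\xi(D)=\sum_{c\text{ type II}}\eta(c)$. Then $\sigma_\xi(D)=\operatorname{sig}(G_\xi(D))-\mu_\xi(D)$, $\det_\xi(D)=|\det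 G_\xi(D)|$, $n_\xi(D)=\operatorname{nul}(G_\xi(D))$. The empty matrix has signature $0$ and determinant $1$. $S^*$-equivalence of spanning surfaces is generated by ambient isotopy, attaching/removing a small tube, and attaching/removing a small half-twisted band. *)

(* Defs.v *)
From HB Require Import structures.
From mathcomp Require Import all_boot all_order all_algebra all_field.

Set Implicit Arguments.
Unset Strict Implicit.
Unset Printing Implicit Defensive.

Import Order.TTheory GRing.Theory Num.Theory.
Local Open Scope ring_scope.

(* A cellularly embedded diagram on a closed connected oriented surface is, up
   to orientation-preserving homeomorphism, a connected combinatorial map all
   of whose vertices have degree 4, with over/under data.  A dart is an
   edge-end at a crossing; [edge] is the other end of the same edge, and [turn]
   is the next dart counterclockwise around the same crossing.

   "Corner d" is the sector at the crossing between dart d and dart [turn d],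
   and [reg d] is the component of the complement of the diagram containing
   that sector, i.e. the one on the left when leaving the crossing along d.
   Following the boundary of that disk counterclockwise (disk on the left), the
   corner after d is [face d] = turn^-1 (edge d).

   A diagram without crossings is cellularly embedded only if it is a single
   circle on the sphere, whose complement is two disks; this is the case where
   there are no darts. *)
Record diagram := Diagram {
  dart : finType;
  region : finType;
  edge : dart -> dart;
  turn : dart -> dart;
  reg : dart -> region;
  over_dart : pred dart;            (* d belongs to the overcrossing strand *)
  outgoing : pred dart;             (* the link is oriented away from the
                                       crossing along d *)
  edgeK : involutive edge;
  edge_neq : forall d, edge d != d;
  turn4 : forall d, iter 4 turn d = d;
  turn2_neq : forall d, turn (turn d) != d;
  surface_connected : forall d d',
    connect (fun x y => (y == edge x) || (y == turn x)) d d';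
  reg_eq : forall d d',
    (reg d == reg d') = fconnect (fun x => iter 3 turn (edge x)) d d';
  reg_onto : (0 < #|dart|)%N -> forall r, exists d, reg d = r;
  circle_regions : #|dart| = 0%N -> #|region| = 2%N;
  over_turn : forall d, over_dart (turn d) = ~~ over_dart d;
  outgoing_edge : forall d, outgoing (edge d) = ~~ outgoing d;
  outgoing_across : forall d, outgoing (turn (turn d)) = ~~ outgoing d
}.

Section Diagrams.
Variable D : diagram.
Implicit Types (d c : dart D) (r b w : region D).

Definition across d := turn (turn d).
Definition turn_back d := iter 3 (@turn D) d.
Definition face d := turn_back (edge d).

(* The two sides of the edge at d are the regions of corners d and
   [turn_back d]. *)
Definition share_edge r r' : Prop :=
  (exists d, (r = reg d /\ r' = reg (turn_back d)) \/
             (r' = reg d /\ r = reg (turn_back d)))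
  \/ (#|dart D| = 0%N /\ r <> r').

(* A coloring is the predicate of its black regions. *)
Definition checkerboard (xi : pred (region D)) : Prop :=
  forall r r', share_edge r r' -> xi r != xi r'.

(* Each crossing has exactly one dart that is over and outgoing; it serves as
   the name of the crossing. *)
Definition is_crossing c := over_dart c && outgoing c.

Variable xi : pred (region D).

Definition black_corner d := xi (reg d).

(* One of the two black corners at the crossing c; the other one is
   [across (black_at c)], and the half-twisted band of the checkerboard surface
   at c joins these two corners. *)
Definition black_at c := if black_corner c then c else turn c.

(* At a black corner d, the two strands of the crossing contain the darts d and
   [turn d].  Orient both in the same direction along the band, i.e. towards
   the crossing along these two darts: since [turn d] follows d
   counterclockwise, the crossing is positive iff the strand of d is over. *)
Definition eta c : int := if over_dart (black_at c) then 1 else -1.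

Definition type_II c := outgoing (black_at c) == outgoing (turn (black_at c)).

Definition mu : int := \sum_(c | is_crossing c && type_II c) eta c.

Definition incident c w :=
  (w == reg (turn (black_at c))) || (w == reg (turn_back (black_at c))).

Definition white_enum n (X : 'I_n.+1 -> region D) : Prop :=
  injective X /\ forall r, ~~ xi r <-> exists i, X i = r.

Definition goeritz_off n (X : 'I_n.+1 -> region D) (i j : 'I_n.+1) : int :=
  - \sum_(c | [&& is_crossing c, incident c (X i) & incident c (X j)]) eta c.

Definition goeritz_entry n (X : 'I_n.+1 -> region D) (i j : 'I_n.+1) : int :=
  if i == j then - \sum_(k | k != i) goeritz_off X i k else goeritz_off X i j.

Definition goeritz n (X : 'I_n.+1 -> region D) : 'M[int]_n :=
  \matrix_(i, j) goeritz_entry X (lift ord0 i) (lift ord0 j).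

End Diagrams.

Definition eigenvalues n (A : 'M[int]_n) : seq algC :=
  sval (closed_field_poly_normal (char_poly (map_mx intr A : 'M[algC]_n))).

Definition sig n (A : 'M[int]_n) : int :=
  (count (fun x => 0 < x) (eigenvalues A))%:Z
  - (count (fun x => x < 0) (eigenvalues A))%:Z.

Definition absdet n (A : 'M[int]_n) : int := `|\det A|.

Definition nul n (A : 'M[int]_n) : nat :=
  (n - \rank (map_mx intr A : 'M[rat]_n))%N.

Section Surfaces.
Variables (D : diagram) (xi : pred (region D)).
Implicit Types (d c : dart D) (b w : region D).

(* Cut the surface along the edges of the dual (white) graph: it becomes one
   polygon N_b per black region b, whose sides, in counterclockwise order,
   correspond to the corners of b.  Opposite sides (those of corners d and
   [across d]) are joined through the crossing: N_b consists of the black disk b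
   and its halves of the neighbouring white disks, and near each crossing
   there is a rectangle joining the two sides.

   A bundle is a family of parallel strands, in general position with respect
   to this decomposition.  Over N_b it lies at height [level]; [flow d] is the
   algebraic number of strands leaving N_b through the side of the black corner
   d, and they do so at position [pos d], measured counterclockwise along that
   side from its middle.  If [twisted], the strands follow the half-twisted band
   of the checkerboard surface across the rectangle; otherwise they cross it
   straight.  A 1-cycle in Sigma x I is a list of bundles. *)
Record bundle := Bundle {
  level : int;
  twisted : bool;
  pos : dart D -> int;
  flow : dart D -> int
}.
Implicit Types (J K : bundle).

(* Counterclockwise rank of corner d on the boundary of its polygon, from some
   fixed corner on; the choice of that corner is immaterial for families of
   strands, whose total flow out of each polygon is zero. *)
Definition rank_in_face d := findex (@face D) (froot (@face D) d) d.

Definition before d (x : int) d' (x' : int) : bool :=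
  (rank_in_face d < rank_in_face d')%N || ((d == d') && (x < x')).

(* Intersection number J . K inside the polygons.  In an oriented disk, the
   intersection number of two families of chords with end points p on the
   boundary circle, cut open at some point, is the sum of J(p) K(q) over
   p before q, where J(p), K(q) are the outward flows: chords with unlinked ends
   contribute zero, and if J runs east to west and K north to south the
   contribution is +1. *)
Definition disk_crossings J K : int :=
  \sum_d \sum_(d' | [&& black_corner xi d, reg d == reg d' &
                        before d (pos J d) d' (pos K d')])
     flow J d * flow K d'.

(* Position of a strand at the far side of the rectangle, in the coordinate of
   the side of d. *)
Definition exit_pos J d : int := if twisted J then - pos J d else pos J d.

(* Intersection number J . K in the rectangle entered through the side of d.
   If both flow outward and J starts clockwise of K but ends counterclockwise
   of it, then (J, K) is a negative frame. *)
Definition band_crossings J K d : int :=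
  flow J d * flow K d *
  ((exit_pos J d < exit_pos K d)%R%:Z - (pos J d < pos K d)%R%:Z).

(* In the half-twisted band, the strand of the diagram through the dart d leaves
   N_b at the counterclockwise end of the side.  The relative position of any
   two strands of the band rotates by the same half turn as that of the two
   strands of the diagram, so the strand that starts counterclockwise of the
   other is over iff d is an overcrossing dart. *)
Definition band_over J K d : bool :=
  if twisted J && twisted K then over_dart d == (pos K d < pos J d)
  else level K < level J.

(* Signed count of the crossings where J passes over K.  The sign of such a
   crossing is its contribution to the intersection number J . K. *)
Definition lk (Js Ks : seq bundle) : int :=
  \sum_(J <- Js) \sum_(K <- Ks)
    ((if level K < level J then disk_crossings J K else 0)
     + \sum_(c | is_crossing c && band_over J K (black_at xi c))
         band_crossings J K (black_at xi c)).

(* Intersection number on the surface of the projections. *)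
Definition intersection (Js Ks : seq bundle) : int :=
  \sum_(J <- Js) \sum_(K <- Ks)
    (disk_crossings J K
     + \sum_(c | is_crossing c) band_crossings J K (black_at xi c)).

(* A cell complex onto which F' = F_xi #_tau Sigma retracts.  F_xi retracts onto the black graph: a vertex in each black disk and an edge
   along the core of each band.  In the parallel copy of Sigma below it, the
   same graph is the 1-skeleton of a cell structure whose 2-cells correspond to
   the white regions.  The tube joins small holes next to the vertices of the
   black region b0 in the two surfaces, in a sector of b0 that faces the white
   region w0.  The cells are:
   - 0-cells: two copies of the black regions;
   - 1-cells: two copies of the edges of the black graph, an edge along the tube
     from the lower copy of b0 to the upper one, and the boundary loops of the
     two holes, based at b0;
   - 2-cells: the white regions of the lower copy, with the hole removed from
     w0, and the annulus of the tube cut along its edge.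

   A 1-chain of the black graph is given by the flow out of the black regions
   through their corners. *)
Definition chain : Type :=
  ({ffun dart D -> int} * {ffun dart D -> int} * int * int * int)%type.

Definition upper (z : chain) : {ffun dart D -> int} := z.1.1.1.1.
Definition lower (z : chain) : {ffun dart D -> int} := z.1.1.1.2.
Definition tube_edge (z : chain) : int := z.1.1.2.
Definition upper_loop (z : chain) : int := z.1.2.
Definition lower_loop (z : chain) : int := z.2.

Definition graph_chain (f : {ffun dart D -> int}) : Prop :=
  forall d, if black_corner xi d then f (across d) = - f d else f d = 0.

(* The coefficient at the black region b of the boundary of a chain f of the
   black graph is minus the flow out of b; the boundary of the edge along the
   tube is upper b0 - lower b0. *)
Definition is_cycle b0 (z : chain) : Prop :=
  [/\ graph_chain (upper z), graph_chain (lower z) &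
      forall b, xi b ->
        - (\sum_(d | reg d == b) upper z d)
          + (if b == b0 then tube_edge z else 0) = 0 /\
        - (\sum_(d | reg d == b) lower z d)
          - (if b == b0 then tube_edge z else 0) = 0].

(* Boundary of the 2-chain with coefficient y w at the white region w and s at
   the tube.  Going counterclockwise around a white region, its boundary passes
   a white corner e at a crossing along the edge of the black graph from corner
   [turn e] to corner [turn_back e]. *)
Definition boundary w0 (y : region D -> int) (s : int) : chain :=
  (0,
   [ffun d => if black_corner xi d
              then y (reg (turn_back d)) - y (reg (turn d)) else 0],
   0, s, y w0 - s).

(* The classes of the cycles z i form a basis of H_1(F'; Z). *)
Definition H1_basis b0 w0 m (z : 'I_m -> chain) : Prop :=
  (forall i, is_cycle b0 (z i)) /\
  forall x, is_cycle b0 x -> exists! k : 'rV[int]_m,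
    exists y s, x - \sum_i (z i) *~ (k 0 i) = boundary w0 y s.

(* F_xi lies at level 0 and the copy of Sigma at level -3.  The loops of the
   holes project to arbitrarily small loops, which contribute neither to linking
   nor to intersection numbers, and the coefficient of the edge along the tube
   is zero in every cycle, since the tube separates F'. *)
Definition core_bundles (z : chain) : seq bundle :=
  [:: Bundle 0 true (fun=> 0) (upper z);
      Bundle (-3) false (fun=> 0) (lower z)].

(* A parallel copy of z, moved sideways off the cores of the bands and by the
   height h.  A line on the half-twisted band parallel to its core has the same
   position at both ends; on a flat rectangle the positions at the two ends
   are opposite, and the orientation of the link is used to choose a side. *)
Definition shifted_bundles (h : int) (z : chain) : seq bundle :=
  [:: Bundle h true (fun=> 1) (upper z);
      Bundle (h - 3) false (fun d => if outgoing d then 1 else -1) (lower z)].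

(* Chains of the double cover of F': over each black disk or white 2-cell it has
   an upper sheet (true) and a lower one (false); a half-twisted band joins the
   upper sheet at one of its ends to the lower sheet at the other.  The transfer
   takes a cell to the sum of its two lifts. *)
Definition transfer (z : chain) : bool -> chain := fun=> z.

Definition cover_bundles (u : bool -> chain) : seq bundle :=
  shifted_bundles 1 (u true) ++ shifted_bundles (-1) (u false).

Definition GL_pairing (x y : chain) : int :=
  lk (cover_bundles (transfer x)) (core_bundles y)
  - intersection (shifted_bundles 0 x) (core_bundles y).

Definition GL_matrix m (z : 'I_m -> chain) : 'M[int]_m :=
  \matrix_(i, j) GL_pairing (z i) (z j).

(* The parallel of the oriented link at distance k from the core of the bands.
   In N_b it follows the boundary edges of the black disk b: near the edge from
   corner d to corner [face d], it runs between position k on the side of d and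
   position -k on that of [face d]. *)
Definition link_bundles (k : int) : seq bundle :=
  let inward d : int := if outgoing d then -1 else 1 in
  [:: Bundle 0 true (fun=> k)
        (fun d => if black_corner xi d then inward d else 0);
      Bundle 0 true (fun=> - k)
        (fun d => if black_corner xi d then inward (turn d) else 0)].

(* The link, at position 2, is the boundary of F'; its push-off, at position 3,
   lies just outside F' along the extension of the black disks and bands. *)
Definition euler_number : int := - lk (link_bundles 2) (link_bundles 3).

(* sigma(D, F'), det(D, F') and n(D, F'), computed in a basis of H_1(F'; Z). *)
Definition surface_signature m (z : 'I_m -> chain) : rat :=
  (sig (GL_matrix z))%:~R + 2^-1 * euler_number%:~R.

Definition surface_det m (z : 'I_m -> chain) : int := absdet (GL_matrix z).

Definition surface_nullity m (z : 'I_m -> chain) : nat := nul (GL_matrix z).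

(* sigma_xi(D), det_xi(D) and n_xi(D), for an enumeration X of the white
   regions. *)
Definition goeritz_signature n (X : 'I_n.+1 -> region D) : int :=
  sig (goeritz xi X) - mu xi.

Definition goeritz_det n (X : 'I_n.+1 -> region D) : int :=
  absdet (goeritz xi X).

Definition goeritz_nullity n (X : 'I_n.+1 -> region D) : nat :=
  nul (goeritz xi X).

End Surfaces.

(* Main.v *)
(** The lattice H_1(F') is the sum of Z_1, the cycles of the black graph, and of
    its quotient H_1(Sigma) by the boundaries of white 2-chains.  In the lower
    copy of Sigma the pairing vanishes, between the two summands it is the
    intersection form I of Sigma, and on Z_1 it is diagonal in the bands, with
    the signs eta on the diagonal.  Choose a basis of H_1(Sigma), which is free
    as a direct summand of H_1(F'), and lift it to Z_1; together with the
    boundaries of all white regions but one, the lifts form a basis of Z_1.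
    Boundaries are I-orthogonal to Z_1, so the Gram matrix is [[G, R, 0],
    [R^T, S, J], [0, J^T, 0]] with G the Goeritz matrix and J unimodular by
    Poincare duality.  Over the rationals this is congruent to the sum of G with
    blocks 1 and -1 of equal size, by a matrix of determinant +-1.  The Euler
    number is computed crossing by crossing. *)
Require Import Defs.
From HB Require Import structures.
From mathcomp Require Import all_boot all_order all_algebra all_field.
From mathcomp Require Import ring.

Set Implicit Arguments.
Unset Strict Implicit.
Unset Printing Implicit Defensive.

Import Order.TTheory GRing.Theory Num.Theory.
Local Open Scope ring_scope.

(** * Inertia and signature *)

Section Signature.
Local Open Scope sesquilinear_scope.

Section Inertia.
Variable C : numClosedFieldType.

Definition npos N (d : 'rV[C]_N) : nat := #|[pred i | 0 < d 0 i]|.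

Lemma diag_form N r (P : 'M[C]_(N, r)) (d : 'rV[C]_r) (v : 'rV[C]_N) :
  (v *m (P *m diag_mx d *m P^t*) *m v^t*) 0 0
  = \sum_i d 0 i * `|(v *m P) 0 i| ^+ 2.
Proof.
rewrite !mulmxA -mulmxA -map_mxM -trmx_mul mxE; apply: eq_bigr => i _.
by rewrite mul_mx_diag !mxE mulrAC normCK mulrC.
Qed.

(* The vectors on which the first form is positive definite meet those on which
   the second one is negative semidefinite only in 0. *)
Lemma inertia_le N r (P : 'M[C]_N) (Q : 'M[C]_(N, r)) d e :
  P \in unitmx -> d \is a realmx -> e \is a realmx ->
  P *m diag_mx d *m P^t* = Q *m diag_mx e *m Q^t* -> (npos d <= npos e)%N.
Proof.
move=> Pu dR eR eqPQ.
pose A := colsub (enum_val : 'I_#|[pred i | ~~ (0 < d 0 i)]| -> 'I_N) P.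
pose B := colsub (enum_val : 'I_#|[pred i | 0 < e 0 i]| -> 'I_r) Q.
(* On a vector killed by [A] and [B] the first form is nonnegative and the second nonpositive, so
   the vector is 0. Hence there are at least [N] columns, which is the inequality. *)
have free : row_free (row_mx A B).
  rewrite -kermx_eq0; apply/rowV0P => v /sub_kermxP.
  rewrite mul_mx_row => /eqP; rewrite row_mx_eq0 => /andP[/eqP vA /eqP vB].
  have vP0 i : ~~ (0 < d 0 i) -> (v *m P) 0 i = 0.
    move=> di; have := congr1 (fun M : 'rV_ _ =>
      M 0 (enum_rank_in (di : i \in [pred i | ~~ (0 < d 0 i)]) i)) vA.
    rewrite [in RHS]mxE => <-; rewrite !mxE; apply: eq_bigr => j _ /=.
    by rewrite mxE enum_rankK_in.
  have vQ0 i : 0 < e 0 i -> (v *m Q) 0 i = 0.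
    move=> di; have := congr1 (fun M : 'rV_ _ =>
      M 0 (enum_rank_in (di : i \in [pred i | 0 < e 0 i]) i)) vB.
    rewrite [in RHS]mxE => <-; rewrite !mxE; apply: eq_bigr => j _ /=.
    by rewrite mxE enum_rankK_in.
  have term_ge0 i : true -> 0 <= d 0 i * `|(v *m P) 0 i| ^+ 2.
    move=> _; have [di|/vP0->] := boolP (0 < d 0 i).
      by rewrite mulr_ge0 ?exprn_ge0 // ltW.
    by rewrite normr0 expr0n mulr0.
  have sum_le0 : \sum_i d 0 i * `|(v *m P) 0 i| ^+ 2 <= 0.
    rewrite -diag_form eqPQ diag_form; apply: sumr_le0 => i _.
    have [/vQ0->|] := boolP (0 < e 0 i); first by rewrite normr0 expr0n mulr0.
    rewrite -real_leNgt ?real0 ?(mxOverP eR) // => ei.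
    by rewrite mulr_le0_ge0 ?exprn_ge0.
  have sum0 : \sum_i d 0 i * `|(v *m P) 0 i| ^+ 2 = 0.
    by apply/eqP; rewrite eq_le sum_le0 sumr_ge0.
  have vP : v *m P = 0.
    apply/rowP => i; rewrite [in RHS]mxE.
    have [di|/vP0//] := boolP (0 < d 0 i).
    have /(_ i isT)/eqP := psumr_eq0P term_ge0 sum0.
    by rewrite mulf_eq0 gt_eqF //= sqrf_eq0 normr_eq0 => /eqP.
  by rewrite -(mulmxK Pu v) vP mul0mx.
have := rank_leq_col (row_mx A B); rewrite (eqP free) => leN.
move: leN; rewrite -[X in (X <= _)%N]card_ord -(cardC [pred i | 0 < d 0 i]).
rewrite [X in (X <= _)%N]addnC leq_add2l => le_de; exact: le_de.
Qed.

Lemma inertia N (P Q : 'M[C]_N) d e :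
  P \in unitmx -> Q \in unitmx -> d \is a realmx -> e \is a realmx ->
  P *m diag_mx d *m P^t* = Q *m diag_mx e *m Q^t* -> npos d = npos e.
Proof.
move=> Pu Qu dR eR eqPQ; apply/eqP.
rewrite eqn_leq (inertia_le Pu dR eR eqPQ).
exact: inertia_le Qu eR dR (esym eqPQ).
Qed.

Lemma char_poly_conj N (P D : 'M[C]_N) : P \in unitmx ->
  char_poly (invmx P *m D *m P) = char_poly D.
Proof.
move=> Pu; rewrite /char_poly.
have -> : char_poly_mx (invmx P *m D *m P) =
    map_mx polyC (invmx P) *m char_poly_mx D *m map_mx polyC P.
  rewrite /char_poly_mx mulmxBr mulmxBl !map_mxM; congr (_ - _).
  by rewrite mul_mx_scalar -scalemxAl -map_mxM mulVmx // map_mx1 scalemx1.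
rewrite !det_mulmx mulrAC -det_mulmx -map_mxM mulVmx // map_mx1 det1 mul1r //.
Qed.

End Inertia.

Definition intC n (A : 'M[int]_n) : 'M[algC]_n := map_mx intr A.

Lemma intC_real n (A : 'M[int]_n) : intC A \is a realmx.
Proof. by apply/mxOverP => i j; rewrite mxE; exact: realz. Qed.


Lemma count_row N (d : 'rV[algC]_N) (a : pred algC) :
  count a [seq d 0 i | i <- enum 'I_N] = #|[pred i | a (d 0 i)]|.
Proof. by rewrite count_map cardE enumT size_filter; apply: eq_count => i;
  rewrite inE. Qed.

Lemma npos_opp N (d : 'rV[algC]_N) : npos (- d) = #|[pred i | d 0 i < 0]|.
Proof. by apply: eq_card => i; rewrite !inE mxE oppr_gt0. Qed.

(** By the spectral theorem; conjugation keeps the characteristic polynomial, so the diagonal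
    entries are the eigenvalues with multiplicity. *)
Lemma symmetric_spectral N (A : 'M[int]_N) : A^T = A ->
  exists P d, [/\ P \in unitmx, d \is a realmx,
    intC A = P *m diag_mx d *m P^t* & sig A = (npos d)%:Z - (npos (- d))%:Z].
Proof.
move=> symA; set B := intC A.
have hermB : B \is hermsymmx.
  apply: realsym_hermsym; last exact: intC_real.
  apply/is_hermitianmxP; rewrite expr0 scale1r map_mx_id // /B /intC.
  by rewrite map_trmx symA.
have /hermitian_normalmx/orthomx_spectralP eqB := hermB.
have := spectral_unitarymx B; have := hermitian_spectral_diag_real hermB.
move: (spectralmx B) (spectral_diag B) eqB => P d eqB dR Pu.
exists (P^t*), d; split=> //.
- by apply: unitarymx_unit; rewrite trmxC_unitary.
- by rewrite trmxCK -invmx_unitary.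
have eig : perm_eq (eigenvalues A) [seq d 0 i | i <- enum 'I_N].
  apply: prod_XsubC_eq; rewrite /eigenvalues.
  case: closed_field_poly_normal => r /= eqr.
  rewrite (monicP (char_poly_monic _)) scale1r in eqr; rewrite -eqr.
  rewrite -[map_mx intr A]/B eqB char_poly_conj ?unitarymx_unit //.
  rewrite char_poly_trig ?diag_mx_is_trig // big_map big_enum.
  by apply: eq_big => // i _; rewrite mxE eqxx mulr1n.
by rewrite /sig !(permP eig) !count_row npos_opp.
Qed.

(** Sylvester's law of inertia; negative entries are counted by applying it to the negated forms. *)
Lemma sig_congr N (A : 'M[int]_N) (P : 'M[algC]_N) e :
  A^T = A -> P \in unitmx -> e \is a realmx ->
  intC A = P *m diag_mx e *m P^t* -> sig A = (npos e)%:Z - (npos (- e))%:Z.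
Proof.
move=> symA Pu eR eqA; have [Q [d [Qu dR eqA' ->]]] := symmetric_spectral symA.
rewrite (inertia Qu Pu dR eR) -?eqA' //; congr (_ - _%:Z).
have oppR (v : 'rV[algC]_N) : v \is a realmx -> - v \is a realmx.
  by move=> vR; apply/mxOverP => i j; rewrite mxE realN (mxOverP vR).
apply: (inertia Qu Pu); rewrite ?oppR //.
by rewrite !(raddfN (@diag_mx _ _)) /= !mulmxN !mulNmx -eqA' -eqA.
Qed.

Lemma npos_row m n (d : 'rV[algC]_m) (e : 'rV[algC]_n) :
  npos (row_mx d e) = (npos d + npos e)%N.
Proof.
rewrite /npos -!sum1_card !(big_mkcond (fun i => i \in _)) big_split_ord /=.
by congr (_ + _)%N; apply: eq_bigr => i _; rewrite !inE ?row_mxEl ?row_mxEr.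
Qed.

Lemma npos_const n (a : algC) :
  npos (const_mx a : 'rV_n) = if 0 < a then n else 0%N.
Proof.
rewrite /npos -sum1_card (eq_bigl (fun=> 0 < a)) => [|i];
  last by rewrite inE mxE.
by case: ifP => _; rewrite ?big_pred0_eq // sum1_card card_ord.
Qed.

(** Rational entries are fixed by complex conjugation, so a rational congruence becomes a Hermitian
    one over [algC]. The blocks 1 and -1 contribute [q] signs of each kind, which cancel. *)
Lemma sig_stabilize n q (A : 'M[int]_(n + (q + q))) (G : 'M[int]_n)
    (W : 'M[rat]_(n + (q + q))) :
  A^T = A -> G^T = G -> W \in unitmx ->
  map_mx intr A = W *m block_mx (map_mx intr G) 0 0
                          (block_mx 1%:M 0 0 (- 1%:M)) *m W^T ->
  sig A = sig G.
Proof.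
move=> symA symG Wu eqA.
have [P [d [Pu dR eqG ->]]] := symmetric_spectral symG.
pose e : 'rV[algC]_(q + q) := row_mx (const_mx 1) (const_mx (- 1)).
pose V : 'M[algC]_(n + (q + q)) := map_mx ratr W *m block_mx P 0 0 1%:M.
have Vu : V \in unitmx.
  by rewrite unitmx_mul map_unitmx Wu unitmxE det_ublock det1 mulr1 -unitmxE.
have eR : row_mx d e \is a realmx.
  apply/mxOverP => i j; rewrite ord1.
  case: (split_ordP j) => k ->; rewrite ?row_mxEl ?row_mxEr ?(mxOverP dR) //.
  by case: (split_ordP k) => l ->; rewrite ?row_mxEl ?row_mxEr mxE ?realN real1.
rewrite (sig_congr symA Vu eR) ?opp_row_mx ?npos_row; last first.
  rewrite /intC.
  have -> : map_mx intr A =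
      map_mx ratr (map_mx intr A : 'M[rat]_(n + (q + q))) :> 'M[algC]__.
    by apply/matrixP => i j; rewrite !mxE ratr_int.
  rewrite eqA !map_mxM /V trmx_mul map_mxM !mulmxA; congr (_ *m _); last first.
    by apply/matrixP => i j; rewrite !mxE; apply/esym/conj_Crat/Crat_rat.
  rewrite -!mulmxA; congr (_ *m _).
  rewrite !map_block_mx tr_block_mx map_block_mx diag_mx_row !mulmx_block.
  rewrite !(mul0mx, mulmx0, addr0, add0r, mul1mx, mulmx1, trmx0, trmx1,
    map_mx0, map_mx1).
  rewrite [in RHS]mulmxA -eqG; congr block_mx.
    by apply/matrixP => i j; rewrite !mxE; apply: ratr_int.
  rewrite diag_mx_row map_mxN map_mx1 !diag_const_mx; congr block_mx.
  by apply/matrixP => i j; rewrite !mxE mulNrn.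
have oppC a : - const_mx a = const_mx (- a) :> 'rV[algC]_q.
  by apply/rowP => i; rewrite !mxE.
by rewrite !oppC !npos_const opprK ltr01 oppr_gt0 ltr10 addn0 add0n !PoszD
  opprD addrACA subrr addr0.
Qed.

End Signature.

(** * Metabolic Gram matrices *)

Definition metabolic (F : nzRingType) n q (G : 'M[F]_n) (R : 'M_(n, q))
    (S J : 'M_q) : 'M_(n + (q + q)) :=
  block_mx G (row_mx R 0) (col_mx R^T 0) (block_mx S J J^T 0).

Definition metabolic_diag (F : nzRingType) n q (G : 'M[F]_n) :
    'M_(n + (q + q)) :=
  block_mx G 0 0 (block_mx 1%:M 0 0 (- 1%:M)).

(** The last [q] basis vectors are isotropic and dual, through [J], to the middle ones. Adding
    multiples of them clears [R] and [S]; the hyperbolic form that remains splits into 1 and -1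
    because 2 is invertible. *)
Lemma metabolic_split (F : numFieldType) n q (G : 'M[F]_n)
    (R : 'M_(n, q)) (S J : 'M_q) :
  S^T = S -> J \in unitmx ->
  exists2 Q : 'M_(n + (q + q)), \det Q ^+ 2 = \det J ^- 2 &
    Q *m metabolic G R S J *m Q^T = metabolic_diag q G.
Proof.
move=> symS Ju.
pose K := invmx J; have KJ : K *m J = 1%:M by rewrite mulVmx.
have JK : J^T *m K^T = 1%:M by rewrite -trmx_mul KJ trmx1.
have half : 2^-1 + 2^-1 = 1 :> F.
  by rewrite -mulr2n -(mulr_natr 2^-1) mulVf ?pnatr_eq0.
pose h : 'M[F]_q := (2^-1)%:M.
have hT : h^T = h by rewrite tr_scalar_mx.
have hh : h + h = 1%:M by rewrite /h -raddfD /= half.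
pose T := K *m S *m K^T.
have TT : T^T = T by rewrite /T !trmx_mul trmxK symS mulmxA.
(* [T] is the form of the middle vectors after the change by [K] that makes them dual to the
   isotropic ones; [Y + Y^T] has to cancel it. *)
pose Y := - (h *m T).
have YT : Y^T = - (T *m h) by rewrite /Y linearN /= trmx_mul TT hT.
have YE : Y + Y^T = - T.
  by rewrite YT /Y -opprD /h mul_mx_scalar mul_scalar_mx -scalerDl half scale1r.
pose C := - (R *m K^T).
have CT : C^T = - (K *m R^T) by rewrite linearN /= trmx_mul trmxK.
have R1 : R + C *m J^T = 0.
  by rewrite /C mulNmx -mulmxA (mulmx1C JK) mulmx1 subrr.
have E1 (x : 'M_q) : K *m S + (Y + x) *m J^T = (x - Y^T) *m J^T.
  have -> : K *m S = T *m J^T by rewrite /T -mulmxA (mulmx1C JK) mulmx1.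
  by rewrite -mulmxDl -(opprK T) -YE opprD addrACA addNr add0r addrC.
clearbody C Y; clear YT YE.
(* The last two block rows add plus and minus half of the isotropic vectors: their squares become 1
   and -1, and their mixed products vanish. *)
exists (block_mx 1%:M (row_mx 0 C) 0 (block_mx K (Y + h) K (Y - h))).
  rewrite det_ublock det1 mul1r.
  have -> : block_mx K (Y + h) K (Y - h) =
      block_mx 1%:M 0 1%:M 1%:M *m block_mx K (Y + h) 0 (- 1%:M).
    rewrite mulmx_block !mul1mx !mul0mx !addr0; congr block_mx.
    by rewrite -hh; rewrite opprD addrA addrK.
  rewrite det_mulmx det_lblock !det1 !mul1r det_ublock -scaleN1r detZ det1
    mulr1.
  by rewrite exprMn -exprM mulnC exprM sqrrN expr1n expr1n mulr1 /K det_inv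
    exprVn.
rewrite /metabolic /metabolic_diag tr_block_mx tr_row_mx tr_block_mx !trmx0
  trmx1.
rewrite !mulmx_block ?mul_row_block ?mul_row_col ?mul_col_row ?mul_block_col.
rewrite !linearD !linearN /= hT.
rewrite !mul1mx !mul0mx !mulmx0 !mulmx1 !addr0 !add0r add_row_mx R1 addr0.
rewrite row_mx0 !mul0mx addr0 !E1 KJ CT mul_block_col mulmx_block !mulmx0
  !add0r !mul1mx.
rewrite add_col_mx subrr col_mx0 !mulmxDl !mulNmx -!mulmxA !JK !mulmx1.
by rewrite !addrA !subrK hh subrr addNr -opprD hh.
Qed.

Lemma det_metabolic_diag (F : comNzRingType) n q (G : 'M[F]_n) :
  \det (metabolic_diag q G) = \det G * (-1) ^+ q.
Proof.
by rewrite /metabolic_diag !det_ublock det1 mul1r -scaleN1r detZ det1 mulr1.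
Qed.

Lemma rank_metabolic_diag (F : fieldType) n q (G : 'M[F]_n) :
  \rank (metabolic_diag q G) = (\rank G + (q + q))%N.
Proof.
by rewrite /metabolic_diag !rank_diag_block_mx mxrank1 mxrank_opp mxrank1.
Qed.

Lemma map_metabolic n q (G : 'M[int]_n) (R : 'M_(n, q)) (S J : 'M_q) :
  map_mx intr (metabolic G R S J) =
  metabolic (map_mx intr G) (map_mx intr R) (map_mx intr S) (map_mx intr J)
    :> 'M[rat]__.
Proof.
rewrite /metabolic !(map_block_mx, map_row_mx, map_col_mx).
by rewrite !map_mx0 !map_trmx.
Qed.

Lemma int_unit_sqr (x : int) : x \is a GRing.unit -> x ^+ 2 = 1.
Proof. by case/orP => /eqP->. Qed.

(** The splitting has denominators, so the comparison takes place over the rationals. The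
    determinants of [U] and [J] square to 1, the sign [(-1) ^+ q] disappears in the absolute value,
    and rank and size both grow by [q + q]. *)
Lemma metabolic_invariants n q (G : 'M[int]_n) (R : 'M_(n, q)) (S J : 'M_q)
    (U : 'M_(n + (q + q))) :
  G^T = G -> S^T = S -> J \in unitmx -> U \in unitmx ->
  let A := U *m metabolic G R S J *m U^T in
  [/\ sig A = sig G, absdet A = absdet G & nul A = nul G].
Proof.
move=> symG symS Ju Uu A.
pose i2q := fun m n (M : 'M[int]_(m, n)) => map_mx intr M : 'M[rat]_(m, n).
have symA : A^T = A.
  by rewrite /A !trmx_mul trmxK /metabolic !tr_block_mx tr_row_mx tr_col_mx
    !trmx0 !trmxK symG symS mulmxA.
have i2qu k (M : 'M[int]_k) : M \in unitmx -> i2q _ _ M \in unitmx.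
  by move=> Mu; rewrite unitmxE det_map_mx rmorph_unit // -unitmxE.
have [Q detQ eqQ] := @metabolic_split rat _ _
  (i2q _ _ G) (i2q _ _ R) (i2q _ _ S) (i2q _ _ J)
  (etrans (map_trmx _ _) (congr1 (i2q _ _) symS)) (i2qu _ _ Ju).
have Qu : Q \in unitmx.
  rewrite unitmxE unitfE -sqrf_eq0 detQ invr_eq0 expf_eq0 /=.
  by rewrite -unitfE -unitmxE i2qu.
pose W := i2q _ _ U *m invmx Q.
have eqA : i2q _ _ A = W *m metabolic_diag q (i2q _ _ G) *m W^T.
  rewrite -eqQ /W /i2q /A !map_mxM map_metabolic !trmx_mul trmx_inv map_trmx.
  by rewrite !mulmxA mulmxKV // mulmxK ?unitmx_tr.
have Wu : W \in unitmx by rewrite unitmx_mul i2qu // unitmx_inv.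
split.
- exact: sig_stabilize symA symG Wu eqA.
- suff detA : \det A = \det G * (-1) ^+ q.
    by rewrite /absdet detA normrM normrX normrN1 expr1n mulr1.
  apply/(@intr_inj rat); rewrite rmorphM rmorphXn rmorphN1 -!det_map_mx.
  rewrite [map_mx _ A]eqA 2!det_mulmx det_tr mulrAC -expr2 det_metabolic_diag.
  rewrite det_mulmx exprMn det_inv exprVn detQ invrK !det_map_mx -!rmorphXn /=.
  by rewrite !int_unit_sqr -?unitmxE // !mul1r.
- rewrite /nul [map_mx intr A]eqA mxrankMfree ?row_free_unit ?unitmx_tr //.
  by rewrite eqmxMfull ?row_full_unit // rank_metabolic_diag subnDr.
Qed.

(** * Lattices *)

(** In the Smith form [L *m D *m R], the rows of [invmx L] at the zero rows of [D] are a basis of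
    the kernel. The columns of [L] at the same indices give coordinates on all vectors, so the
    kernel is a direct summand. *)
Lemma int_kernel_split p r (A : 'M[int]_(p, r)) :
  exists q (B : 'M[int]_(q, p)) (C : 'M[int]_(p, q)),
    [/\ B *m C = 1%:M, B *m A = 0 &
        forall v : 'rV_p, v *m A = 0 -> v *m C *m B = v].
Proof.
have [L Lu [R Ru [d _ eqA]]] := int_Smith_normal_form A.
set D := (\matrix_(i, j) _) in eqA.
pose f := enum_val : 'I_#|[pred i | row i D == 0]| -> 'I_p.
exists #|[pred i | row i D == 0]|, (rowsub f (invmx L)), (colsub f L); split.
- rewrite mul_rowsub_mx mulmx_colsub mulVmx //.
  by apply/matrixP => i j; rewrite !mxE (inj_eq enum_val_inj).
- rewrite eqA !mulmxA !mul_rowsub_mx mulVmx // mul1mx -mul_rowsub_mx.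
  suff -> : rowsub f D = 0 by rewrite mul0mx.
  by apply/row_matrixP => i; rewrite row_rowsub row0; have /eqP := enum_valP i.
move=> v; rewrite eqA !mulmxA mulmx_colsub => /(canRL (mulmxK Ru)).
rewrite mul0mx => uD; rewrite -[RHS](mulmxK Lu); move: (v *m L) uD => u uD.
(* The only nonzero entry of such a row is on the diagonal, so it cannot be cancelled by other
   rows. *)
have u0 i : row i D != 0 -> u 0 i = 0.
  case/rV0Pn => j; rewrite !mxE mulrb; have [eq_ij di|//] := eqVneq (i : nat) j.
  have := congr1 (fun w : 'rV_ _ => w 0 j) uD; rewrite !mxE (bigD1 i) //= big1.
    by rewrite mxE eq_ij eqxx mulr1n addr0 -eq_ij => /eqP;
      rewrite mulf_eq0 (negPf di) orbF => /eqP.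
  move=> k ki; rewrite mxE mulrb ifN ?mulr0 //.
  by apply: contraNneq ki => eq_kj; apply/eqP/val_inj; rewrite /= eq_kj.
apply/rowP => j; rewrite !mxE.
under eq_bigr do rewrite !mxE.
rewrite -(big_enum_val (fun i => u 0 i * invmx L i j)) /= big_mkcond /=.
by apply: eq_bigr => i _; rewrite inE; case: ifPn => // /u0->; rewrite mul0r.
Qed.

(** * Bases of quotients and Gram matrices *)

Section Quotients.
Variable V : zmodType.

Definition subgroup (P : V -> Prop) := P 0 /\ forall x y,
  P x -> P y -> P (x - y).

Definition lin m (x : 'I_m -> V) (k : 'rV[int]_m) : V := \sum_i x i *~ k 0 i.

(** Representatives of a basis of the quotient of [Z] by [B], without forming the quotient group; a
    trivial [B] gives bases of [Z] itself. *)
Definition basis_mod (Z B : V -> Prop) m (x : 'I_m -> V) :=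
  (forall i, Z (x i)) /\
  forall v, Z v -> exists! k : 'rV[int]_m, B (v - lin x k).

Lemma linB m (x : 'I_m -> V) k l : lin x (k - l) = lin x k - lin x l.
Proof.
by rewrite /lin -sumrB; apply: eq_bigr => i _; rewrite !mxE mulrzBr.
Qed.

Lemma lin_subf m (x y : 'I_m -> V) k :
  lin (fun i => x i - y i) k = lin x k - lin y k.
Proof. by rewrite /lin -sumrB; apply: eq_bigr => i _; rewrite mulrzBl. Qed.

Lemma lin0 m (x : 'I_m -> V) : lin x 0 = 0.
Proof. by rewrite /lin big1 // => i _; rewrite mxE. Qed.

Lemma lin_mul m n (x : 'I_n -> V) (k : 'rV_m) (M : 'M_(m, n)) :
  lin x (k *m M) = lin (fun i => lin x (row i M)) k.
Proof.
rewrite /lin; under [RHS]eq_bigr do rewrite mulrz_suml; rewrite exchange_big /=.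
apply: eq_bigr => j _; rewrite mxE mulrz_sumr.
by apply: eq_bigr => i _; rewrite mxE mulrC mulrzA.
Qed.

Lemma lin_delta m (x : 'I_m -> V) i : lin x (delta_mx 0 i) = x i.
Proof.
rewrite /lin (bigD1 i) //= mxE !eqxx mulr1z big1 ?addr0 // => j ji.
by rewrite mxE (negPf ji) andbF mulr0z.
Qed.

Lemma morph_sumMz (W : zmodType) (f : V -> W) (I : finType) (x : I -> V) k :
  zmod_morphism f -> f (\sum_i x i *~ k i) = \sum_i f (x i) *~ k i.
Proof.
move=> fB; pose F : {additive V -> W} := HB.pack f (GRing.isZmodMorphism.Build
  _ _ f fB).
by rewrite -[f]/(F : V -> W) raddf_sum; apply: eq_bigr => i _; rewrite raddfMz.
Qed.

Lemma lin_morph (W : zmodType) (f : V -> W) m (x : 'I_m -> V) k :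
  zmod_morphism f -> f (lin x k) = \sum_i f (x i) *~ k 0 i.
Proof. exact: morph_sumMz. Qed.

Section Subgroup.
Variables (P : V -> Prop) (subP : subgroup P).

Lemma subgroup0 : P 0. Proof. by case: subP. Qed.

Lemma subgroupB x y : P x -> P y -> P (x - y).
Proof. by case: subP => _; apply. Qed.

Lemma subgroupN x : P x -> P (- x).
Proof. by rewrite -sub0r; apply: subgroupB; exact: subgroup0. Qed.

Lemma subgroupD x y : P x -> P y -> P (x + y).
Proof. by move=> Px Py; rewrite -(opprK y); apply/subgroupB/subgroupN. Qed.

Lemma subgroupMz x k : P x -> P (x *~ k).
Proof.
move=> Px; have PMn n : P (x *+ n).
  by elim: n => [|n IH]; [exact: subgroup0|rewrite mulrS; exact: subgroupD].
by case: k => n; [exact: PMn|rewrite NegzE mulrNz; apply/subgroupN/PMn].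
Qed.

Lemma subgroup_lin m (x : 'I_m -> V) k : (forall i, P (x i)) -> P (lin x k).
Proof.
move=> Px; rewrite /lin; elim/big_ind: _ => [||i _]; [exact: subgroup0| |].
  exact: subgroupD.
exact: subgroupMz.
Qed.
End Subgroup.

Section BasisMod.
Variables (Z B : V -> Prop) (subZ : subgroup Z) (subB : subgroup B).

Lemma basis_modP m (x : 'I_m -> V) :
  basis_mod Z B x <->
  [/\ forall i, Z (x i), forall v, Z v -> exists k, B (v - lin x k)
    & forall k, B (lin x k) -> k = 0].
Proof.
split=> [[Zx xP]|[Zx ex un]].
  split=> // [v /xP[k [Bk _]]|k Bk]; first by exists k.
  have [l [_ lP]] := xP 0 (subgroup0 subZ).
  have l0 : l = 0 by apply: lP; rewrite lin0 subr0; exact: subgroup0.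
  have lk : l = - k by apply: lP; rewrite -(sub0r k) linB lin0 !sub0r opprK.
  by apply: oppr_inj; rewrite oppr0 -lk.
split=> // v /ex[k Bk]; exists k; split=> // l Bl.
apply/eqP; rewrite -subr_eq0; apply/eqP/un; rewrite linB.
have -> : lin x k - lin x l = (v - lin x l) - (v - lin x k).
  by rewrite opprB [RHS]addrC addrA subrK.
exact: subgroupB.
Qed.

Lemma basis_mod_coords m (x : 'I_m -> V) n (v : 'I_n -> V) :
  basis_mod Z B x -> (forall i, Z (v i)) ->
  exists M : 'M_(n, m), forall i, B (v i - lin x (row i M)).
Proof.
case/basis_modP => _ ex _ Zv.
have [M MP] := fin_all_exists (fun i => ex _ (Zv i)).
by exists (\matrix_i M i) => i; rewrite rowK.
Qed.

(** Expanding one family in the other and back expresses it in itself modulo [B], so independence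
    makes the products of the coordinate matrices the identity. *)
Lemma basis_mod_change m (x : 'I_m -> V) n (y : 'I_n -> V) :
  basis_mod Z B x -> basis_mod Z B y ->
  exists (P : 'M_(m, n)) (Q : 'M_(n, m)),
    [/\ P *m Q = 1%:M, Q *m P = 1%:M & forall i, B (x i - lin y (row i P))].
Proof.
move=> bx basis_y; have [Zx _ ux] := (basis_modP x).1 bx.
have [Zy _ uy] := (basis_modP y).1 basis_y.
have [P PP] := basis_mod_coords basis_y Zx;
  have [Q QP] := basis_mod_coords bx Zy.
have main p q (u : 'I_p -> V) (v : 'I_q -> V) (M : 'M_(p, q)) (N : 'M_(q, p)) :
    (forall k, B (lin u k) -> k = 0) ->
    (forall i, B (u i - lin v (row i M))) ->
    (forall i, B (v i - lin u (row i N))) -> M *m N = 1%:M.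
  move=> uu MP NP; apply/eqP; rewrite -subr_eq0; apply/eqP/row_matrixP => i.
  rewrite row0; apply: uu; rewrite linearB /= row_mul linB lin_mul row1
    lin_delta.
  rewrite -opprB; apply: subgroupN => //.
  rewrite -(subrK (lin v (row i M)) (u i)) -addrA -lin_subf.
  by apply: subgroupD => //; exact: subgroup_lin.
by exists P, Q; split=> //; [exact: (main _ _ x y)|exact: (main _ _ y x)].
Qed.

Lemma basis_mod_size m (x : 'I_m -> V) n (y : 'I_n -> V) :
  basis_mod Z B x -> basis_mod Z B y -> m = n.
Proof.
move=> bx /(basis_mod_change bx)[P [Q [PQ QP _]]].
by apply/eqP; rewrite eqn_leq (mulmx1_min PQ) (mulmx1_min QP).
Qed.

Definition gram m (b : V -> V -> int) (x : 'I_m -> V) : 'M[int]_m :=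
  \matrix_(i, j) b (x i) (x j).

(** A form vanishing between [B] and [Z] descends to the quotient, where a change of basis is an
    invertible integer matrix. *)
Lemma gram_change m (x y : 'I_m -> V) (b : V -> V -> int) :
  (forall u, zmod_morphism (b u)) -> (forall v, zmod_morphism (b^~ v)) ->
  (forall u v, B u -> Z v -> b u v = 0) -> (forall u v, Z u -> B v -> b u v =
    0) ->
  basis_mod Z B x -> basis_mod Z B y ->
  exists2 P, P \in unitmx & gram b x = P *m gram b y *m P^T.
Proof.
move=> br bl b0l b0r bx basis_y.
have [P [Q [PQ QP PP]]] := basis_mod_change bx basis_y.
have [Zx _ _] := (basis_modP x).1 bx; have [Zy _ _] := (basis_modP y).1 basis_y.
exists P; first by case/mulmx1_unit: PQ.
have Zl i : Z (lin y (row i P)) by exact: subgroup_lin.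
apply/matrixP => i j; rewrite [LHS]mxE.
have -> : b (x i) (x j) = b (lin y (row i P)) (lin y (row j P)).
  apply/eqP; rewrite -subr_eq0 -[X in X - _](subrK (b (lin y (row i P)) (x j))).
  rewrite -(bl (x j)) b0l // add0r -br b0r //.
rewrite (lin_morph _ _ (bl _)) [RHS]mxE; under [RHS]eq_bigr do rewrite !mxE.
under [RHS]eq_bigr do rewrite mulr_suml.
rewrite exchange_big /=; apply: eq_bigr => k _.
rewrite (lin_morph _ _ (br _)) mxE -mulrzr mulr_suml; apply: eq_bigr => l _.
by rewrite !mxE !intz -mulrzr intz mulrC mulrA.
Qed.
End BasisMod.
End Quotients.

(** * Pairs of cycles, the second one modulo boundaries *)

Section Double.
Variable U : zmodType.
Variables (Z B : U -> Prop) (subZ : subgroup Z) (subB : subgroup B).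
Hypothesis BZ : forall u, B u -> Z u.

(* The pair stands for the cycle of F' with these parts in F_xi and in the copy
   of Sigma; the latter matters up to boundaries. *)
Definition double_cycle (p : U * U) : Prop := Z p.1 /\ Z p.2.
Definition double_boundary (p : U * U) : Prop := p.1 = 0 /\ B p.2.

Lemma subgroup_double_cycle : subgroup double_cycle.
Proof.
split=> [|x y [Zx1 Zx2] [Zy1 Zy2]]; split;
  by [exact: subgroup0|exact: subgroupB].
Qed.

Lemma subgroup_double_boundary : subgroup double_boundary.
Proof.
split=> [|x y [Bx1 Bx2] [By1 By2]]; split=> //=; first exact: subgroup0.
  by rewrite Bx1 By1 subrr.
exact: subgroupB.
Qed.

Let fstB : zmod_morphism (@fst U U). Proof. by []. Qed.
Let sndB : zmod_morphism (@snd U U). Proof. by []. Qed.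

Lemma lin_fst m (x : 'I_m -> U * U) k : (lin x k).1 = lin (fun i => (x i).1) k.
Proof. exact: (lin_morph _ _ fstB). Qed.

Lemma lin_snd m (x : 'I_m -> U * U) k : (lin x k).2 = lin (fun i => (x i).2) k.
Proof. exact: (lin_morph _ _ sndB). Qed.

(* The endomorphism [(u, v) |-> (0, v)] of the double has an idempotent matrix,
   whose image is a free direct summand. *)
Lemma basis_of_double m (x : 'I_m -> U * U) :
  basis_mod double_cycle double_boundary x ->
  exists q (h : 'I_q -> U), basis_mod Z B h.
Proof.
have sC := subgroup_double_cycle; have sD := subgroup_double_boundary.
move=> bx; have [Zx ex un] := (basis_modP sC sD x).1 bx.
pose low i : U * U := (0, (x i).2).
have Zlow i : double_cycle (low i) by split; [exact: subgroup0|case: (Zx i)].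
have [P PP] := basis_mod_coords sC sD bx Zlow.
have linlow k : double_boundary (lin low k - lin x (k *m P)).
  by rewrite lin_mul -lin_subf; apply: subgroup_lin.
have low2 k : (lin low k).2 = lin (fun i => (x i).2) k by rewrite lin_snd.
have low1 k : (lin low k).1 = 0.
  by rewrite lin_fst /lin big1 // => i _; rewrite mul0rz.
have fixP k : (lin x k).1 = 0 -> k *m (1%:M - P) = 0.
  move=> k0; apply: un; rewrite mulmxBr mulmx1 linB.
  suff -> : lin x k = lin low k by exact: linlow.
  by apply/eqP; rewrite -pair_eqE /pair_eq /= k0 low1 low2 lin_snd !eqxx.
(* The vectors fixed by [P] are the coordinates of the elements with first component 0. The rows of
   [C] are a basis of them, and [C'] recovers the coefficients. *)
have [q [C [C' [CC' CP CK]]]] := int_kernel_split (1%:M - P).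
exists q, (fun j => lin (fun i => (x i).2) (row j C)).
have Zx2 i : Z (x i).2 by case: (Zx i).
apply/(basis_modP subZ subB); split.
- by move=> j; apply: subgroup_lin.
- move=> v Zv; have [|k [k1 k2]] := ex (0, v).
    by split=> //=; exact: subgroup0.
  exists (k *m C'); rewrite -lin_mul CK; last first.
    by apply: fixP; apply/esym/eqP; rewrite -subr_eq0; apply/eqP.
  by rewrite -lin_snd.
move=> c; rewrite -lin_mul => Bc.
rewrite -[c]mulmx1 -CC' mulmxA; suff -> : c *m C = 0 by rewrite mul0mx.
apply: un.
have -> : c *m C = (c *m C) *m P.
  apply/eqP; rewrite -subr_eq0 -[X in X - _]mulmx1 -mulmxBr.
  by rewrite -mulmxA CP mulmx0.
rewrite -[lin _ _](subKr (lin low (c *m C))); apply: subgroupB => //.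
by split; rewrite ?low1 ?low2.
Qed.

(** The order matches the blocks of [metabolic]: boundaries and then lifted classes in the first
    factor, the same classes in the second. *)
Definition double_family n q (w : 'I_n -> U) (h : 'I_q -> U)
    (i : 'I_(n + (q + q))) : U * U :=
  match split i with
  | inl i => (w i, 0)
  | inr j => match split j with inl j => (h j, 0) | inr j => (0, h j) end
  end.

Section DoubleFamily.
Variables (n q : nat) (w : 'I_n -> U) (h : 'I_q -> U).
Let y := double_family w h.

Lemma double_family1 i : y (lshift _ i) = (w i, 0).
Proof. by rewrite /y /double_family (unsplitK (inl i)). Qed.

Lemma double_family2 i : y (rshift _ (lshift _ i)) = (h i, 0).
Proof. by rewrite /y /double_family (unsplitK (inr _)) (unsplitK (inl i)). Qed.

Lemma double_family3 i : y (rshift _ (rshift _ i)) = (0, h i).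
Proof. by rewrite /y /double_family !(unsplitK (inr _)). Qed.

Lemma lin_double_family (k : 'rV_n) (c d : 'rV_q) :
  lin y (row_mx k (row_mx c d)) = (lin w k + lin h c, lin h d).
Proof.
have zpair (u v : U) z : (u, v) *~ z = (u *~ z, v *~ z).
  apply/eqP; rewrite -pair_eqE /pair_eq /=.
  by rewrite (raddfMz (@fst U U)) (raddfMz (@snd U U)) !eqxx.
rewrite /lin !big_split_ord /=.
under eq_bigr do rewrite double_family1 row_mxEl zpair mul0rz.
under [X in _ + (X + _)]eq_bigr do rewrite double_family2 row_mxEr row_mxEl
  zpair mul0rz.
under [X in _ + (_ + X)]eq_bigr do rewrite double_family3 !row_mxEr zpair
  mul0rz.
apply/eqP; rewrite -pair_eqE /pair_eq /= !(raddf_sum (@fst U U)) !(raddf_sum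
  (@snd U U)) /=.
by rewrite !big1_eq !addr0 !add0r !eqxx.
Qed.

(** Subtracting a combination of [h] takes a cycle into [B], where [w] supplies the rest; so [w] and
    [h] together are a basis of [Z]. *)
Lemma double_family_basis : basis_mod B (fun u => u = 0) w -> basis_mod Z B h ->
  basis_mod double_cycle double_boundary y.
Proof.
have s0 : subgroup (fun u : U => u = 0) by split=> // u v -> ->; rewrite subrr.
have sC := subgroup_double_cycle; have sD := subgroup_double_boundary.
move=> /(basis_modP subB s0)[Bw exw unw] /(basis_modP subZ subB)[Zh exh unh].
have Z0 := subgroup0 subZ; have B0 := subgroup0 subB.
apply/(basis_modP sC sD); split.
- move=> i; case: (split_ordP i) => j ->; first by rewrite double_family1;
    split=> //=; exact/BZ/Bw.
  by case: (split_ordP j) => k ->; rewrite ?double_family2 ?double_family3;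
    split=> /=.
- case=> u v [/exh[c Bc] /exh[d Bd]]; have [k k0] := exw _ Bc.
  exists (row_mx k (row_mx c d)); rewrite lin_double_family; split=> //=.
  by rewrite [lin w k + _]addrC opprD addrA.
move=> k; rewrite -(hsubmxK k) -(hsubmxK (rsubmx k)) lin_double_family.
case=> /= k1 /unh ->.
have c0 : lsubmx (rsubmx k) = 0.
  apply: unh; rewrite -[lin h _](addKr (lin w (lsubmx k))) k1 addr0.
  by apply: subgroupN => //; exact: subgroup_lin.
by rewrite c0 row_mx0 (unw (lsubmx k)) ?row_mx0 // -k1 c0 lin0 addr0.
Qed.
End DoubleFamily.

Section Form.
Variables (b I : U -> U -> int).
Hypotheses (br : forall u, zmod_morphism (b u)).
Hypotheses (bC : forall u v, b u v = b v u).
Hypotheses (Ir : forall u, zmod_morphism (I u)).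
Hypotheses (Il : forall v, zmod_morphism (I^~ v)).
Hypothesis (I_skew : forall u v, Z u -> Z v -> I u v = - I v u).
Hypothesis (I_boundary : forall u v, B u -> Z v -> I u v = 0).
Variables (r : nat) (e : 'I_r -> U) (coord : U -> 'rV[int]_r).
Hypotheses (Ze : forall i, Z (e i)) (coordB : zmod_morphism coord).
Hypothesis (coordK : forall u, Z u -> lin e (coord u) = u).
Hypothesis (duality : forall f : U -> int, zmod_morphism f ->
  (forall u, B u -> f u = 0) -> exists2 a, Z a & forall v, Z v -> I a v = f v).

(** The Gordon-Litherland pairing of F' in terms of its two sheets. The copy of Sigma does not pair
    with itself; the minus sign makes the mixed terms symmetric for skew [I]. *)
Definition double_form (p p' : U * U) : int :=
  b p.1 p'.1 + I p.1 p'.2 - I p.2 p'.1.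

(** Duality represents the coordinate functionals of the quotient by cycles; the coordinates of
    these cycles form a left inverse of the Gram matrix. *)
Lemma duality_unit q (h : 'I_q -> U) : basis_mod Z B h -> gram I h \in unitmx.
Proof.
move=> bh; have [Zh _ un] := (basis_modP subZ subB h).1 bh.
(* [coord] is defined on all of [U], so composing it with [K] extends the coordinate functionals
   from [Z] to [U], as [duality] requires. *)
have [K KP] := basis_mod_coords subZ subB bh Ze.
pose f j u : int := (coord u *m K) 0 j.
have linK u : Z u -> B (u - lin h (coord u *m K)).
  by move=> Zu; rewrite -{1}(coordK Zu) lin_mul -lin_subf; apply: subgroup_lin.
have fB j : zmod_morphism (f j).
  by move=> u v; rewrite /f coordB mulmxBl !mxE.
have f0 j u : B u -> f j u = 0.
  move=> Bu; rewrite /f (un (coord u *m K)) ?mxE //.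
  by rewrite -[lin _ _](subKr u); apply: subgroupB => //; apply/linK/BZ.
have [a Za aP] : exists2 a, forall j, Z (a j)
    & forall j v, Z v -> I (a j) v = f j v.
  have ex j : exists a, Z a /\ forall v, Z v -> I a v = f j v.
    by have [a Za aP] := duality (fB j) (f0 j); exists a.
  by have [a aP] := fin_all_exists ex; exists a => j; case: (aP j).
have [A AP] := basis_mod_coords subZ subB bh Za.
suff AJ : A *m gram I h = 1%:M by case/mulmx1_unit: AJ.
apply/matrixP => j i; rewrite !mxE.
have -> : \sum_k A j k * gram I h k i = I (lin h (row j A)) (h i).
  rewrite (lin_morph _ _ (Il (h i))); apply: eq_bigr => k _.
  by rewrite !mxE -mulrzr intz mulrC.
have -> : I (lin h (row j A)) (h i) = I (a j) (h i).
  apply/eqP; rewrite eq_sym -subr_eq0 -(Il (h i)) I_boundary //.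
rewrite aP // /f.
suff -> : coord (h i) *m K = delta_mx 0 i by rewrite mxE eqxx.
apply/eqP; rewrite -subr_eq0 -oppr_eq0 opprB; apply/eqP/un.
by rewrite linB lin_delta; exact: linK.
Qed.

Lemma double_form_invariants n (w : 'I_n -> U) m (x : 'I_m -> U * U) :
  basis_mod B (fun u => u = 0) w -> basis_mod double_cycle double_boundary x ->
  [/\ sig (gram double_form x) = sig (gram b w),
      absdet (gram double_form x) = absdet (gram b w) &
      nul (gram double_form x) = nul (gram b w)].
Proof.
move=> bw bx; have [q [h bh]] := basis_of_double bx.
have sC := subgroup_double_cycle; have sD := subgroup_double_boundary.
have basis_y := double_family_basis bw bh.
have Bw := bw.1; have Zh := bh.1.
have eq_m := basis_mod_size sC sD bx basis_y; subst m.
have bl v : zmod_morphism (b^~ v) by move=> u u'; rewrite /= !(bC _ v) br.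
have morph0 (f : U -> int) : zmod_morphism f -> f 0 = 0.
  by move=> fB; rewrite -(subrr 0) fB subrr.
have [|||//|P Pu ->] := gram_change sC sD (b := double_form) _ _ _ _ bx basis_y.
- by move=> p p1 p2; rewrite /double_form /= br Ir Ir; ring.
- by move=> p p1 p2; rewrite /double_form /= bl (Il p.2) (Il p.1); ring.
- move=> u v [u1 Bu2] [Zv1 _].
  by rewrite /double_form u1 (morph0 _ (bl _)) (morph0 _ (Il _)) I_boundary //
    subr0.
- move=> u v [Zu1 _] [v1 Bv2].
  rewrite /double_form v1 (morph0 _ (br _)) (morph0 _ (Ir _)) I_skew
    ?I_boundary //.
  exact: BZ.
(* The zeros next to [R] come from the vanishing of [I] between boundaries and cycles. *)
have -> : gram double_form (double_family w h) =
    metabolic (gram b w) (\matrix_(i, j) b (w i) (h j)) (gram b h) (gram I h).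
  apply/matrixP => i j; rewrite mxE /metabolic /double_form.
  case: (split_ordP i) => i' ->; case: (split_ordP j) => j' ->;
    rewrite ?(double_family1, block_mxEul, block_mxEur, block_mxEdl,
      block_mxEdr).
  - by rewrite mxE /= (morph0 _ (Ir _)) (morph0 _ (Il _)) addr0 subr0.
  - case: (split_ordP j') => k ->;
      rewrite ?(double_family2, double_family3) ?(row_mxEl, row_mxEr) mxE /=.
      by rewrite (morph0 _ (Ir _)) (morph0 _ (Il _)) addr0 subr0.
    by rewrite (morph0 _ (br _)) (morph0 _ (Il _)) I_boundary // subr0.
  - case: (split_ordP i') => k ->;
      rewrite ?(double_family2, double_family3) ?(col_mxEu, col_mxEd) !mxE /=.
      by rewrite (morph0 _ (Ir _)) (morph0 _ (Il _)) addr0 subr0 bC.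
    rewrite (morph0 _ (bl _)) (morph0 _ (Il _)) I_skew ?I_boundary ?subrr //.
    exact: BZ.
  case: (split_ordP i') => k ->; case: (split_ordP j') => l ->;
    rewrite ?(double_family2, double_family3) ?(block_mxEul, block_mxEur,
      block_mxEdl, block_mxEdr) !mxE /=.
  - by rewrite (morph0 _ (Ir _)) (morph0 _ (Il _)) addr0 subr0.
  - by rewrite (morph0 _ (br _)) (morph0 _ (Il _)) add0r subr0.
  - by rewrite (morph0 _ (bl _)) (morph0 _ (Il _)) !add0r -I_skew.
  by rewrite (morph0 _ (bl _)) (morph0 _ (Il _)) (morph0 _ (Ir _)) addr0 subr0.
apply: metabolic_invariants => //; last exact: duality_unit.
- by apply/matrixP => i j; rewrite !mxE bC.
- by apply/matrixP => i j; rewrite !mxE bC.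
Qed.
End Form.
End Double.

(** * The diagram *)

Section DartCalculus.
Variable D : diagram.
Implicit Types d c e : dart D.

Definition face_inv d : dart D := edge (turn d).

Lemma turn_turn_back d : turn (turn_back d) = d. Proof. exact: turn4. Qed.
Lemma turn_backK d : turn_back (turn d) = d. Proof. exact: turn4. Qed.
Lemma acrossK d : across (across d) = d. Proof. exact: turn4. Qed.
Lemma turn_across d : turn (across d) = turn_back d. Proof. by []. Qed.
Lemma across_turn d : across (turn d) = turn_back d. Proof. by []. Qed.
Lemma turn_back_across d : turn_back (across d) = turn d.
Proof. exact: (turn4 (turn d)). Qed.

Lemma face_invK d : face (face_inv d) = d.
Proof. by rewrite /face /face_inv edgeK turn_backK. Qed.
Lemma faceK d : face_inv (face d) = d.
Proof. by rewrite /face /face_inv turn_turn_back edgeK. Qed.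
Lemma face_inj : injective (@face D). Proof. exact: can_inj faceK. Qed.

Lemma reg_connect d d' : (reg d == reg d') = fconnect (@face D) d d'.
Proof. exact: reg_eq. Qed.
Lemma reg_face d : reg (face d) = reg d.
Proof. by apply/eqP; rewrite eq_sym reg_connect fconnect1. Qed.
Lemma reg_face_inv d : reg (face_inv d) = reg d.
Proof. by rewrite -reg_face face_invK. Qed.
Lemma reg_edge d : reg (edge d) = reg (turn_back d).
Proof. by rewrite -reg_face /face edgeK. Qed.

Lemma over_across d : over_dart (across d) = over_dart d.
Proof. by rewrite !over_turn negbK. Qed.
Lemma over_turn_back d : over_dart (turn_back d) = ~~ over_dart d.
Proof. by rewrite -turn_across over_turn over_across. Qed.

(** Among the four darts of a crossing exactly one is over and outgoing, so its rotations run
    through all darts once. *)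
Lemma sum_darts (F : dart D -> int) :
  \sum_d F d = \sum_(c | is_crossing c)
    (F c + F (turn c) + F (across c) + F (turn_back c)).
Proof.
have shift (f g : dart D -> dart D) (fK : cancel f g) (gK : cancel g f) :
    \sum_(c | is_crossing c) F (f c) = \sum_d (is_crossing (g d))%:R * F d.
  rewrite big_mkcond (reindex_onto g f) => [|d _]; last exact: fK.
  apply: eq_big => d; rewrite gK ?eqxx // => _.
  by case: ifP => _; rewrite ?mul1r ?mul0r.
rewrite !big_split /=.
rewrite (shift id id) // (shift _ _ turn_backK turn_turn_back).
rewrite (shift _ _ acrossK acrossK) (shift _ _ turn_turn_back turn_backK).
rewrite -!big_split /=; apply: eq_bigr => d _.
rewrite -!mulrDl -[LHS]mul1r; congr (_ * _).
rewrite /is_crossing over_across over_turn_back over_turn.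
have -> : outgoing (turn_back d) = ~~ outgoing (turn d).
  by rewrite -across_turn outgoing_across.
rewrite outgoing_across.
by case: (over_dart d); case: (outgoing d); case: (outgoing (turn d)).
Qed.

Lemma froot_reg d d' : reg d = reg d' -> froot (@face D) d = froot (@face D) d'.
Proof.
by move/eqP; rewrite reg_connect => dd';
  apply/(fingraph.rootP (fconnect_sym face_inj)).
Qed.

Lemma connect_froot d : fconnect (@face D) (froot (@face D) d) d.
Proof.
by rewrite fconnect_sym; [exact: connect_root|exact: face_inj].
Qed.

Lemma rank_inj d d' : reg d = reg d' -> rank_in_face d =
  rank_in_face d' -> d = d'.
Proof.
move=> rr; rewrite /rank_in_face (froot_reg rr) => eq_rank.
rewrite -(iter_findex (connect_froot d)) (froot_reg rr) eq_rank.
by rewrite iter_findex // connect_froot.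
Qed.

(** The second case is the last corner of the polygon, from which the walk returns to the root. *)
Lemma rank_face d :
  rank_in_face (face d) = (rank_in_face d).+1 \/
  rank_in_face (face d) = 0%N /\
    forall p, reg p = reg d -> (rank_in_face p < (rank_in_face d).+1)%N.
Proof.
rewrite /rank_in_face (froot_reg (reg_face d)).
set r := froot _ d; have rd := connect_froot d.
have eq_face : face d = iter (findex (@face D) r d).+1 (@face D) r.
  by rewrite iterS iter_findex.
have := findex_max rd; rewrite leq_eqVlt => /orP[/eqP max|lt_max]; last first.
  by left; rewrite eq_face findex_iter.
right; split.
  by rewrite eq_face max iter_order ?findex0 //; exact: face_inj.
move=> p rp; rewrite (froot_reg rp) max; apply: findex_max.
by rewrite -/r /r -(froot_reg rp) connect_froot.
Qed.

(** A discrete primitive of [a] along the boundary of the polygon, starting at the corner of rank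
    0. *)
Definition psum (a : dart D -> int) d : int :=
  \sum_(p | (reg p == reg d) && (rank_in_face p < rank_in_face d)%N) a p.

(** At the last corner the primitive drops back to 0, consistently because the total is zero. *)
Lemma psum_face (a : dart D -> int) d : \sum_(p | reg p == reg d) a p = 0 ->
  psum a (face d) = psum a d + a d.
Proof.
move=> a0; rewrite /psum reg_face.
have snoc : \sum_(p | (reg p == reg d) && (rank_in_face p < (rank_in_face
  d).+1)%N) a p
    = psum a d + a d.
  rewrite (bigD1 d) ?eqxx ?ltnSn //= addrC; congr (_ + _); apply: eq_bigl => p.
  rewrite ltnS leq_eqVlt -andbA; case: eqP => //= rp;
    case: (eqVneq p d) => [->|npd] /=.
    by rewrite ltnn andbF.
  by rewrite andbT; case: eqP => //= /(rank_inj rp) eq_pd;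
    rewrite eq_pd eqxx in npd.
case: (rank_face d) => [->//|[-> last]].
rewrite big_pred0 => [|p]; last by rewrite andbF.
rewrite -snoc -[LHS]a0; apply: eq_bigl => p; case: eqP => //= rp.
by rewrite last.
Qed.

Lemma face_invariant (g : dart D -> int) : (forall d, g (face d) = g d) ->
  forall d d', reg d = reg d' -> g d = g d'.
Proof.
move=> gP d d' /eqP; rewrite reg_connect => /iter_findex <-.
by elim: (findex _ _ _) => //= k ->; rewrite gP.
Qed.

End DartCalculus.

(** * Cycles of the black graph and their intersection form *)

Section BlackGraph.
Variables (D : diagram) (xi : pred (region D)).
Hypothesis xi_checkerboard : checkerboard xi.
Implicit Types d c e : dart D.

Local Notation black := (black_corner xi).
Local Notation U := {ffun dart D -> int}.

Lemma black_turn_back d : black (turn_back d) = ~~ black d.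
Proof.
have : xi (reg d) != xi (reg (turn_back d)).
  by apply: xi_checkerboard; left; exists d; left.
by rewrite /black_corner; case: (xi _); case: (xi _).
Qed.

Lemma black_turn d : black (turn d) = ~~ black d.
Proof. by rewrite -[d in RHS]turn_backK black_turn_back negbK. Qed.

Lemma black_across d : black (across d) = black d.
Proof. by rewrite /across !black_turn negbK. Qed.

Lemma black_edge d : black (edge d) = ~~ black d.
Proof. by rewrite -black_turn_back /black_corner reg_edge. Qed.

Lemma black_face d : black (face d) = black d.
Proof. by rewrite /black_corner reg_face. Qed.

Lemma black_black_at c : black (black_at xi c).
Proof. by rewrite /black_at; case: ifP => // bc; rewrite black_turn bc. Qed.

Lemma sum_black (h : dart D -> int) : \sum_(d | black d) h d =
  \sum_(c | is_crossing c) (h (black_at xi c) + h (across (black_at xi c))).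
Proof.
rewrite big_mkcond sum_darts; apply: eq_bigr => c _.
rewrite /black_at black_turn black_across black_turn_back.
by case: ifP => _ /=; rewrite ?across_turn !(addr0, add0r).
Qed.

Definition black_cycle (a : U) : Prop :=
  graph_chain xi a /\ forall b, xi b -> \sum_(d | reg d == b) a d = 0.

Definition white_boundary (y : region D -> int) : U :=
  [ffun d => if black d then y (reg (turn_back d)) - y (reg (turn d)) else 0].

Definition is_boundary (a : U) : Prop := exists y, a = white_boundary y.

Lemma graph_across a d : graph_chain xi a -> a (across d) = - a d.
Proof.
move=> ga; have := ga d; case: ifP => // bd ad.
by rewrite ad oppr0; have := ga (across d); rewrite black_across bd.
Qed.

Lemma subgroup_black_cycle : subgroup black_cycle.
Proof.
split; first by split=> [d|b _]; [case: ifP;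
  rewrite !ffunE ?oppr0|apply: big1 => d _; rewrite ffunE].
move=> u v [gu su] [gv sv]; split=> [d|b xb].
  have := gu d; have := gv d; rewrite !ffunE; case: ifP => _ -> ->;
    first by ring.
  by rewrite subr0.
by under eq_bigr do rewrite !ffunE; rewrite sumrB su // sv // subr0.
Qed.

Lemma subgroup_boundary : subgroup is_boundary.
Proof.
split; first by exists (fun=> 0); apply/ffunP => d;
  rewrite !ffunE subrr if_same.
move=> _ _ [y ->] [y' ->]; exists (fun r => y r - y' r).
by apply/ffunP => d; rewrite !ffunE; case: ifP => _; ring.
Qed.

(* [T d] is the flow along the edge of the diagram at d, where a black region
   is on the left when leaving along d. *)
Definition flow_chain (T : dart D -> int) : U :=
  [ffun d => if black d then T d - T (face_inv d) else 0].

Lemma sum_flow_chain T b : \sum_(d | reg d == b) flow_chain T d = 0.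
Proof.
case xb : (xi b); last first.
  by apply: big1 => d /eqP db; rewrite ffunE /black_corner db xb.
under eq_bigr => d /eqP db do rewrite ffunE /black_corner db xb.
rewrite sumrB [X in X - _](reindex_inj (can_inj (@face_invK D))) /=.
by under eq_bigl do rewrite reg_face_inv; rewrite subrr.
Qed.

(** Each edge of the diagram carries the coefficient of the white region on its other side. *)
Lemma white_boundary_flow y :
  white_boundary y = flow_chain (fun d => y (reg (edge d))).
Proof.
apply/ffunP => d; rewrite !ffunE; case: ifP => // _.
by rewrite !reg_edge -(reg_edge (face_inv d)) /face_inv edgeK.
Qed.

Lemma boundary_cycle a : is_boundary a -> black_cycle a.
Proof.
case=> y ->; split=> [d|b _]; last by rewrite white_boundary_flow
  sum_flow_chain.
rewrite !ffunE black_across; case: (black d) => //.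
by rewrite turn_back_across turn_across opprB.
Qed.

(* The first cycle is pushed off the cores of the bands, as in
   [shifted_bundles 0]; along a half-twisted band it crosses the core once. *)
Definition isect (a b : U) : int :=
  \sum_(d | black d) psum a d * b d
  + \sum_(c | is_crossing c) a (black_at xi c) * b (black_at xi c).

Lemma isect_morph_r a : zmod_morphism (isect a).
Proof.
move=> b b'; rewrite /isect.
under eq_bigr do rewrite !ffunE mulrBr.
under [X in _ + X]eq_bigr do rewrite !ffunE mulrBr.
by rewrite !sumrB; ring.
Qed.

Lemma isect_morph_l b : zmod_morphism (isect^~ b).
Proof.
move=> a a'; rewrite /isect.
have psumB d : psum (a - a') d = psum a d - psum a' d.
  by rewrite /psum -sumrB; apply: eq_bigr => p _; rewrite !ffunE.
under eq_bigr do rewrite psumB mulrBl.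
under [X in _ + X]eq_bigr do rewrite !ffunE mulrBl.
by rewrite !sumrB; ring.
Qed.

Lemma sum_black_invariant (g : dart D -> int) b : black_cycle b ->
  (forall d, g (face d) = g d) -> \sum_(d | black d) g d * b d = 0.
Proof.
move=> [_ sb] gP; rewrite (partition_big (@reg D) xi) //=.
apply: big1 => r xr.
have [d0 /eqP rd0|none] := pickP (fun d => reg d == r); last first.
  by apply: big1 => d /andP[_]; rewrite none.
rewrite (eq_bigr (fun d => g d0 * b d)) => [|d /andP[_ /eqP rd]].
  rewrite -mulr_sumr (eq_bigl (fun d => reg d == r)) ?sb ?mulr0 // => d.
  by rewrite /black_corner; case: eqP => [->|]; rewrite ?xr ?andbF.
by rewrite (face_invariant gP (etrans rd (esym rd0))).
Qed.

(** The partial sums of [flow_chain T] differ from [T] at the preceding corner by a constant on each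
    polygon, and such constants do not contribute against a cycle. What remains is local at the
    crossings. *)
Lemma isect_flow T b : black_cycle b ->
  isect (flow_chain T) b = \sum_(c | is_crossing c)
    (T (black_at xi c) - T (face_inv (across (black_at xi c))))
    * b (black_at xi c).
Proof.
move=> cb; rewrite /isect.
have -> : \sum_(d | black d) psum (flow_chain T) d * b d =
    \sum_(d | black d) T (face_inv d) * b d.
  apply/eqP; rewrite -subr_eq0 -sumrB; apply/eqP.
  under eq_bigr do rewrite -mulrBl.
  pose g d := if black d then psum (flow_chain T) d - T (face_inv d) else 0.
  rewrite (eq_bigr (fun d => g d * b d)) => [|d bd]; last by rewrite /g bd.
  apply: sum_black_invariant => // d; rewrite /g black_face; case: ifP => // bd.
  by rewrite psum_face ?sum_flow_chain // faceK ffunE bd; ring.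
rewrite sum_black -big_split /=; apply: eq_bigr => c _.
by rewrite (graph_across _ cb.1) ffunE black_black_at; ring.
Qed.

(** The two edges compared in [isect_flow] bound the same white corner, so they carry the same
    coefficient. *)
Lemma isect_boundary u v : is_boundary u -> black_cycle v -> isect u v = 0.
Proof.
move=> [y ->] cv; rewrite white_boundary_flow isect_flow //.
apply: big1 => c _; rewrite /face_inv edgeK turn_across reg_edge.
by rewrite subrr mul0r.
Qed.

(** Summed over all pairs of corners of a polygon, [u p * v d] gives 0. The pairs of either order
    give the two disk terms, and the diagonal is twice the band term, the two ends of a band
    contributing equally. *)
Lemma isect_skew u v : black_cycle u -> black_cycle v ->
  isect u v = - isect v u.
Proof.
move=> [gu su] [gv sv]; apply/eqP; rewrite -addr_eq0 /isect.
pose P d d' := black d && (reg d' == reg d).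
have psumE (a b : U) : \sum_(d | black d) psum a d * b d =
    \sum_d \sum_(p | P d p && (rank_in_face p < rank_in_face d)%N) a p * b d.
  rewrite big_mkcond; apply: eq_bigr => d _; rewrite /P; case: (black d) => /=.
    by rewrite /psum mulr_suml.
  by rewrite big_pred0.
have total : \sum_d \sum_(p | P d p) u p * v d = 0.
  apply: big1 => d _; rewrite /P; case bd: (black d); last by rewrite big_pred0.
  by rewrite -mulr_suml su // mul0r.
have diag : \sum_(d | black d) u d * v d =
  2 * \sum_(c | is_crossing c) u (black_at xi c) * v (black_at xi c).
  rewrite sum_black mulr_sumr; apply: eq_bigr => c _.
  by rewrite (graph_across _ gu) (graph_across _ gv); ring.
have swap : \sum_(d | black d) psum v d * u d =
    \sum_d \sum_(p | P d p && (rank_in_face d < rank_in_face p)%N) u p * v d.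
  rewrite psumE (exchange_big_dep xpredT) //=; apply: eq_bigr => d _.
  apply: eq_big => [p|p _]; last by rewrite mulrC.
  by rewrite /P eq_sym; case: eqP => [e|]; rewrite ?andbF // /black_corner e.
have split3 : \sum_d \sum_(p | P d p) u p * v d =
  \sum_(d | black d) psum u d * v d + \sum_(d | black d) psum v d * u d
  + \sum_(d | black d) u d * v d.
  rewrite psumE swap (big_mkcond black) -!big_split /=; apply: eq_bigr => d _.
  rewrite (bigID (fun p => (rank_in_face p < rank_in_face d)%N)) /= -addrA;
    congr (_ + _).
  rewrite (bigID (fun p => (rank_in_face d < rank_in_face p)%N)) /=;
    congr (_ + _).
    by apply: eq_bigl => p; case: ltngtP; rewrite ?andbF ?andbT.
  rewrite /P; case bd: (black d) => /=; last by rewrite big_pred0.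
  rewrite (bigD1 d) ?eqxx ?ltnn //= big1 ?addr0 // => p.
  rewrite -!leqNgt -!andbA => /and4P[/eqP rp r1 r2 /eqP[]].
  by apply: rank_inj => //; apply/eqP; rewrite eqn_leq r1 r2.
rewrite total diag in split3; apply/eqP; rewrite [RHS]split3.
under [X in _ + (_ + X)]eq_bigr do rewrite mulrC.
by ring.
Qed.

End BlackGraph.

(** * Poincare duality, and the cycles as a direct summand *)

Section Duality.
Variables (D : diagram) (xi : pred (region D)).
Hypothesis xi_checkerboard : checkerboard xi.
Implicit Types d c e : dart D.

Local Notation black := (black_corner xi).
Local Notation U := {ffun dart D -> int}.

Lemma ffun_eval_morph d : zmod_morphism (fun u : U => u d).
Proof. by move=> u v; rewrite !ffunE. Qed.

Lemma functional_sum (f : U -> int) : zmod_morphism f ->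
  exists F : dart D -> int, forall u, f u = \sum_d F d * u d.
Proof.
move=> fB; pose delta d : U := [ffun e => (e == d)%:R].
exists (fun d => f (delta d)) => u.
have {1}-> : u = \sum_d delta d *~ u d.
  apply/ffunP => e; rewrite (morph_sumMz _ _ (ffun_eval_morph e)).
  rewrite (bigD1 e) //= big1 => [|d de]; first by rewrite ffunE eqxx intz addr0.
  by rewrite ffunE eq_sym (negPf de) mul0rz.
by rewrite (morph_sumMz _ _ fB); apply: eq_bigr => d _; rewrite -mulrzr intz.
Qed.

Lemma sum_white (h : dart D -> int) : \sum_(e | ~~ black e) h e =
  \sum_(c | is_crossing c)
    (h (turn_back (black_at xi c)) + h (turn (black_at xi c))).
Proof.
rewrite (reindex_inj (can_inj (@turn_turn_back D))) /=.
under eq_bigl do rewrite black_turn_back // negbK.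
by rewrite sum_black //; apply: eq_bigr => c _; rewrite turn_back_across.
Qed.

(* A functional vanishing on boundaries is a cycle of the white graph; pushing
   it to the boundaries of the white regions gives a cycle of the 4-valent
   graph, which is then pushed into the black regions. *)
Lemma poincare_duality (f : U -> int) : zmod_morphism f ->
  (forall u, is_boundary xi u -> f u = 0) ->
  exists2 a, black_cycle xi a &
    forall v, black_cycle xi v -> isect xi a v = f v.
Proof.
move=> fB f0; have [F fF] := functional_sum fB.
(* The value of [f] on the core of the band, oriented out of the corner [d]. *)
pose phi d := F d - F (across d).
have phiN d : phi (across d) = - phi d by rewrite /phi acrossK opprB.
have fphi v : graph_chain xi v ->
    f v = \sum_(c | is_crossing c) phi (black_at xi c) * v (black_at xi c).
  move=> gv; rewrite fF (bigID black) /= [X in _ + X]big1 ?addr0 => [|d bd].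
    rewrite sum_black //; apply: eq_bigr => c _.
    by rewrite (graph_across xi_checkerboard _ gv) /phi; ring.
  by have := gv d; rewrite (negPf bd) => ->; rewrite mulr0.
(* At a white corner, the value on the adjacent band. That [f] vanishes on the boundary of a white
   region says that [g] sums to zero around it. *)
pose g e := if black e then 0 else phi (turn e).
have g0 d : \sum_(e | reg e == reg d) g e = 0.
  case bd: (black d).
    by apply: big1 => e /eqP ed; rewrite /g /black_corner ed [xi _]bd.
  have := f0 _ (ex_intro _ (fun r => (r == reg d)%:R) erefl).
  rewrite fphi; last exact: (boundary_cycle xi_checkerboard (ex_intro _ _
    erefl)).1.
  move=> f_y0; rewrite -[RHS]f_y0;
    transitivity (\sum_(e | ~~ black e) (reg e == reg d)%:R * phi (turn e)).
    rewrite big_mkcond [RHS]big_mkcond; apply: eq_bigr => e _.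
    rewrite /g /black_corner; case: eqP => [->|_];
      last by rewrite mul0r if_same.
    by rewrite [xi _]bd /= mul1r.
  rewrite sum_white; apply: eq_bigr => c _.
  by rewrite ffunE black_black_at // turn_turn_back -[turn (turn _)]/(across
    _) phiN; ring.
(* A primitive of [g] around the white regions; [T] moves it across the edges to the black side. *)
pose W e := - psum g (face e).
have WP e : W (face_inv e) - W e = g e.
  by rewrite /W face_invK psum_face //; ring.
pose T d := W (edge d).
exists (flow_chain xi T).
  split=> [d|b _]; last exact: sum_flow_chain.
  rewrite !ffunE black_across //; case bd: (black d) => //.
  rewrite /T /face_inv !edgeK turn_across.
  have := WP (turn_back d); rewrite /face_inv turn_turn_back.
  have := WP (turn d); rewrite /face_inv -/(across d).
  rewrite /g black_turn_back // black_turn // bd /= turn_turn_back -/(across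
    d) phiN.
  by move=> /(canRL (subrK _))-> /(canRL (subrK _))->; ring.
move=> v cv; rewrite isect_flow // fphi; last exact: cv.1.
apply: eq_bigr => c _; congr (_ * _); rewrite /T /face_inv edgeK turn_across.
set d := black_at xi c; have := WP (turn_back d).
by rewrite /face_inv /g black_turn_back // black_black_at //= turn_turn_back.
Qed.

(** Cycles are the kernel of an integer matrix: [A1] expresses antisymmetry along the bands, [A2]
    zero outflow from the black regions. *)
Lemma black_cycle_split : exists r (e : 'I_r -> U) (coord : U -> 'rV[int]_r),
  [/\ forall i, black_cycle xi (e i), zmod_morphism coord
    & forall u, black_cycle xi u -> lin e (coord u) = u].
Proof.
pose N := #|dart D|.
pose enc (u : U) : 'rV[int]_N := \row_i u (enum_val i).
pose dec (v : 'rV[int]_N) : U := [ffun d => v 0 (enum_rank d)].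
have decK v : enc (dec v) = v by apply/rowP => i; rewrite !mxE ffunE enum_valK.
have encK u : dec (enc u) = u by apply/ffunP => d;
  rewrite !ffunE mxE enum_rankK.
pose A1 : 'M[int]_N := \matrix_(i, j)
  let p := enum_val i in let d := enum_val j in
  if black d then (p == across d)%:R + (p == d)%:R else (p == d)%:R.
pose A2 : 'M[int]_N := \matrix_(i, j)
  (black (enum_val j) && (reg (enum_val i) == reg (enum_val j)))%:R.
have sum_eq (u : U) d : \sum_p u p * (p == d)%:R = u d.
  rewrite (bigD1 d) //= eqxx mulr1 big1 ?addr0 // => p pd.
  by rewrite (negPf pd) mulr0.
have A1E u i : (enc u *m A1) 0 i = if black (enum_val i)
    then u (across (enum_val i)) + u (enum_val i) else u (enum_val i).
  rewrite mxE; under eq_bigr do rewrite !mxE /=.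
  rewrite -(big_enum_val (A := dart D) (fun p =>
    u p * (if black (enum_val i) then (p == across (enum_val i))%:R +
      (p == enum_val i)%:R else (p == enum_val i)%:R))) /=.
  case: ifP => _; last exact: sum_eq.
  by under eq_bigr do rewrite mulrDr; rewrite big_split /= !sum_eq.
have A2E u i : (enc u *m A2) 0 i = if black (enum_val i)
    then \sum_(p | reg p == reg (enum_val i)) u p else 0.
  rewrite mxE; under eq_bigr do rewrite !mxE /=.
  rewrite -(big_enum_val (A := dart D) (fun p =>
    u p * (black (enum_val i) && (reg p == reg (enum_val i)))%:R)) /=.
  case: ifP => _ /=; last by apply: big1 => p _; rewrite mulr0.
  by rewrite [RHS]big_mkcond; apply: eq_bigr => p _; case: eqP;
    rewrite ?mulr1 ?mulr0.
have cycleP u : black_cycle xi u <-> enc u *m row_mx A1 A2 = 0.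
  rewrite mul_mx_row; split=> [[gu su]|/eqP].
    apply/eqP; rewrite row_mx_eq0; apply/andP; split; apply/eqP/rowP => i.
      rewrite A1E [RHS]mxE; have := gu (enum_val i).
      by case: ifP => // _ ->; rewrite addNr.
    by rewrite A2E [RHS]mxE; case: ifP => // bi; apply: su.
  rewrite row_mx_eq0 => /andP[/eqP u1 /eqP u2]; split=> [d|b xb].
    have := congr1 (fun v : 'rV_ _ => v 0 (enum_rank d)) u1.
    rewrite A1E mxE enum_rankK; case: ifP => // _ /eqP.
    by rewrite addr_eq0 => /eqP.
  have [d0 /eqP rd0|none] := pickP (fun d => reg d == b);
    last by rewrite big_pred0.
  have := congr1 (fun v : 'rV_ _ => v 0 (enum_rank d0)) u2.
  by rewrite A2E mxE enum_rankK /black_corner rd0 xb.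
have [r [B [C [_ BA BK]]]] := int_kernel_split (row_mx A1 A2).
exists r, (fun i => dec (row i B)), (fun u => enc u *m C); split.
- by move=> i; apply/cycleP; rewrite decK -row_mul BA row0.
- by move=> u v; rewrite -mulmxBl; congr (_ *m _); apply/rowP => i;
    rewrite !mxE !ffunE.
move=> u /cycleP/BK encu; rewrite -[RHS]encK -[X in _ = dec X]encu.
apply/ffunP => d; rewrite (lin_morph _ _ (ffun_eval_morph d)) ffunE mxE.
by apply: eq_bigr => i _; rewrite ffunE [row i B 0 _]mxE -mulrzr intz mulrC.
Qed.

End Duality.

(** * Boundaries of white regions and the Goeritz matrix *)

Section WhiteRegions.
Variables (D : diagram) (xi : pred (region D)).
Hypothesis xi_checkerboard : checkerboard xi.
Variables (b0 : region D) (b0_black : xi b0).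
Variables (n : nat) (X : 'I_n.+1 -> region D) (X_white : white_enum xi X).
Implicit Types d c e : dart D.

Local Notation black := (black_corner xi).
Local Notation U := {ffun dart D -> int}.

(** Coefficients with zero boundary agree on the two sides of every band, and the diagram is
    connected. *)
Lemma white_connected y : white_boundary xi y = 0 ->
  forall r r', ~~ xi r -> ~~ xi r' -> y r = y r'.
Proof.
move=> y0 r r' wr wr'.
have [nodart|hasdart] := posnP #|dart D|.
  apply/eqP/negPn/negP => yrr'.
  (* Without crossings there are only two regions, and [b0] is a black one. *)
  have uniq3 : uniq [:: b0; r; r'].
    rewrite /= !inE !negb_or andbT -andbA; apply/and3P; split.
    - by apply: contraNneq wr => <-.
    - by apply: contraNneq wr' => <-.
    - by apply: contraNneq yrr' => ->.
  have := max_card [pred s in [:: b0; r; r']].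
  by rewrite (circle_regions nodart) (card_uniqP uniq3).
(* The coefficient on the white side of the edge at [d]. *)
pose Y d := if black d then y (reg (edge d)) else y (reg d).
have Y_edge d : Y (edge d) = Y d.
  by rewrite /Y black_edge // edgeK; case: (black d).
have Y_turn d : Y (turn d) = Y d.
  rewrite /Y black_turn //; case: ifPn => bd;
    first by rewrite (negPf bd) -(reg_face_inv d).
  rewrite negbK in bd; rewrite bd; have := congr1 (fun u : U => u d) y0.
  rewrite !ffunE bd reg_edge => /eqP.
  by rewrite subr_eq0 => /eqP ->.
have Y_const d d' : Y d = Y d'.
  have /connectP[p] := surface_connected d d'; elim: p d => [d _ ->//|e p IH d].
  rewrite /= => /andP[/orP[]/eqP-> pe le].
    by rewrite -Y_edge; exact: IH.
  by rewrite -Y_turn; exact: IH.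
have [d rd] := reg_onto hasdart r; have [d' rd'] := reg_onto hasdart r'.
have := Y_const d d'.
by rewrite /Y /black_corner rd rd' (negPf wr) (negPf wr').
Qed.

Definition white_cell (i : 'I_n.+1) : U :=
  white_boundary xi (fun r => (r == X i)%:R).

Lemma white_indicator r : ~~ xi r -> \sum_i (r == X i)%:R = 1 :> int.
Proof.
move=> /X_white.2[i <-]; rewrite (bigD1 i) //= eqxx big1 ?addr0 // => j ji.
by rewrite (inj_eq X_white.1) eq_sym (negPf ji).
Qed.

Lemma sum_white_cell : \sum_i white_cell i = 0.
Proof.
apply/ffunP => d; rewrite sum_ffunE !ffunE; under eq_bigr do rewrite ffunE.
case bd: (black d); last by rewrite big1_eq.
rewrite sumrB !white_indicator ?subrr //.
  by rewrite -[xi _]/(black (turn d)) black_turn // bd.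
by rewrite -[xi _]/(black (turn_back d)) black_turn_back // bd.
Qed.

Lemma lin_white_cell (k : 'rV_n) :
  lin (fun i => white_cell (lift ord0 i)) k =
  white_boundary xi (fun r => \sum_i k 0 i * (r == X (lift ord0 i))%:R).
Proof.
apply/ffunP => d; rewrite (lin_morph _ _ (ffun_eval_morph d)) !ffunE.
under eq_bigr do rewrite !ffunE -mulrzr intz.
case: ifP => _; last by apply: big1 => i _; rewrite mul0r.
by rewrite -sumrB; apply: eq_bigr => i _; ring.
Qed.

(** Adding a constant to [y] keeps its boundary, so the coefficient at [X ord0] can be made 0; by
    connectedness there is no further relation. *)
Lemma white_cell_basis : basis_mod (is_boundary xi) (fun u => u = 0)
  (fun i => white_cell (lift ord0 i)).
Proof.
have s0 : subgroup (fun u : U => u = 0) by split=> // u v -> ->; rewrite subrr.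
apply/(basis_modP (subgroup_boundary xi) s0); split.
- by move=> i; eexists.
- move=> _ [y ->]; exists (\row_i (y (X (lift ord0 i)) - y (X ord0))).
  rewrite lin_white_cell; apply/ffunP => d; rewrite !ffunE;
    case bd: (black d); last by rewrite subr0.
  have white_val r : ~~ xi r -> \sum_i (\row_j (y (X (lift ord0 j)) - y (X
    ord0))) 0 i * (r == X (lift ord0 i))%:R = y r - y (X ord0).
    move=> wr; transitivity (\sum_i (y (X i) - y (X ord0)) * (r == X i)%:R).
      by rewrite big_ord_recl subrr mul0r add0r; apply: eq_bigr => i _;
        rewrite mxE.
    have [i <-] := (X_white.2 r).1 wr;
      rewrite (bigD1 i) //= eqxx mulr1 big1 ?addr0 // => j ji.
    by rewrite (inj_eq X_white.1) eq_sym (negPf ji) mulr0.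
  rewrite !white_val; first by ring.
    by rewrite -[xi _]/(black (turn d)) black_turn // bd.
  by rewrite -[xi _]/(black (turn_back d)) black_turn_back // bd.
move=> k; rewrite lin_white_cell => k0; apply/rowP => i; rewrite mxE.
have wX j : ~~ xi (X j) by apply/X_white.2; exists j.
have := white_connected k0 (wX (lift ord0 i)) (wX ord0).
rewrite [RHS]big1 => [<-|j _]; last by rewrite (inj_eq X_white.1) mulr0.
rewrite (bigD1 i) //= eqxx mulr1 big1 ?addr0 // => j ji.
by rewrite (inj_eq X_white.1) (inj_eq lift_inj) eq_sym (negPf ji) mulr0.
Qed.

Definition band_form (a b : U) : int :=
  \sum_(c | is_crossing c) Defs.eta xi c * a (black_at xi c) * b (black_at xi
    c).

Lemma band_formC a b : band_form a b = band_form b a.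
Proof. by apply: eq_bigr => c _; ring. Qed.

Lemma band_form_morph a : zmod_morphism (band_form a).
Proof.
by move=> b b'; rewrite /band_form -sumrB; apply: eq_bigr => c _;
  rewrite !ffunE; ring.
Qed.

(** A band contributes only if the two regions lie on its two sides; their boundaries then run along
    its core in opposite directions, whence the minus sign. *)
Lemma band_form_off i j : i != j ->
  band_form (white_cell i) (white_cell j) = goeritz_off xi X i j.
Proof.
move=> ij; have Xij : X i != X j by rewrite (inj_eq X_white.1).
rewrite /band_form /goeritz_off -sumrN big_mkcond [RHS]big_mkcond /=;
  apply: eq_bigr => c _.
case: (is_crossing c) => //=; rewrite !ffunE black_black_at // /incident.
rewrite !(eq_sym (X _)).
have excl r : ~~ ((r == X i) && (r == X j)).
  by apply: contra Xij => /andP[/eqP <-].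
move: (excl (reg (turn (black_at xi c)))) (excl (reg (turn_back (black_at xi
  c)))).
by do 4!case: (_ == X _) => //=; move=> _ _; ring.
Qed.

(** The white cells sum to zero, so the diagonal entries are determined by the others as in
    [goeritz_entry]. *)
Lemma band_form_goeritz :
  gram band_form (fun i => white_cell (lift ord0 i)) = goeritz xi X.
Proof.
apply/matrixP => i j; rewrite !mxE /goeritz_entry.
have [<-|ij] := eqVneq i j; last by rewrite (inj_eq lift_inj) (negPf ij)
  band_form_off // (inj_eq lift_inj).
rewrite eqxx; move: (lift _ _) => {i j} i.
have : band_form (white_cell i) (\sum_k white_cell k) = 0.
  rewrite sum_white_cell; have := band_form_morph (white_cell i) 0 0.
  by rewrite !subrr.
have := @morph_sumMz _ _ _ _ white_cell (fun=> 1) (band_form_morph (white_cell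
  i)).
under eq_bigr do rewrite mulr1z; move=> ->; under eq_bigr do rewrite mulr1z.
rewrite (bigD1 i) //= => /eqP; rewrite addr_eq0 => /eqP ->; congr (- _).
by apply: eq_bigr => k ki; rewrite band_form_off // eq_sym.
Qed.

End WhiteRegions.

(** * The Gordon-Litherland pairing and the Euler number *)

Section Pairing.
Variables (D : diagram) (xi : pred (region D)).
Hypothesis xi_checkerboard : checkerboard xi.
Implicit Types d c e : dart D.

Local Notation black := (black_corner xi).
Local Notation U := {ffun dart D -> int}.
Local Notation at_c := (black_at xi).

Definition vertex_sum (a b : dart D -> int) : int :=
  \sum_(d | black d) psum a d * b d.

Definition edge_sum (a b : dart D -> int) : int :=
  \sum_(c | is_crossing c) a (at_c c) * b (at_c c).

(** On a common side, a strand precedes the core at position 0 iff its own position is negative. *)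
Lemma disk_crossings_core (J K : bundle D) : pos K = (fun=> 0) ->
  disk_crossings xi J K = vertex_sum (flow J) (flow K)
    + \sum_(d | black d && (pos J d < 0)) flow J d * flow K d.
Proof.
move=> K0; rewrite /disk_crossings (exchange_big_dep xpredT) /vertex_sum /=;
  last by [].
rewrite [X in _ + X]big_mkcondr /= [X in X + _]big_mkcond [X in _ +
  X]big_mkcond -big_split /=.
apply: eq_bigr => d' _; case bd': (black d'); last first.
  apply: big1 => d /and3P[bd /eqP rd _].
  by rewrite /black_corner -rd [xi _]bd in bd'.
rewrite /psum mulr_suml /before K0.
rewrite (bigID (fun d => (rank_in_face d < rank_in_face d')%N)) /=;
  congr (_ + _).
  apply: eq_bigl => d; rewrite -andbA; case: eqP => [rd|_];
    last by rewrite andbF.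
  by rewrite /black_corner rd [xi _]bd' /=; case: ltnP => //=; rewrite andbF.
case: ifP => pd'.
  rewrite (big_pred1 d') // => d /=; case: (eqVneq d d') => [->|_]; last first.
    by case: ltnP; rewrite ?andbF.
  by rewrite ltnn eqxx bd' pd'.
by apply: big1 => d; case: (eqVneq d d') => [->|_];
  rewrite ?pd' ?ltnn ?andbF //; case: ltnP; rewrite ?andbF.
Qed.

Lemma sum_and_const (P : pred (dart D)) (b : bool) (F : dart D -> int) :
  \sum_(c | P c && b) F c = if b then \sum_(c | P c) F c else 0.
Proof.
by case: b; [apply: eq_bigl => c; rewrite andbT|apply: big1 => c;
  rewrite andbF].
Qed.

Lemma sum_band_twisted P l l' t (a b : dart D -> int) :
  \sum_(c | P c) band_crossings (Bundle l true (fun=> 1) a)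
                    (Bundle l' t (fun=> 0) b) (at_c c)
  = \sum_(c | P c) a (at_c c) * b (at_c c).
Proof.
apply: eq_bigr => c _.
by rewrite /band_crossings /exit_pos /= oppr0 if_same mulr1.
Qed.

Lemma sum_band_straight P l l' t p (a b : dart D -> int) :
  \sum_(c | P c) band_crossings (Bundle l false p a)
                    (Bundle l' t (fun=> 0) b) (at_c c) = 0.
Proof.
apply: big1 => c _.
by rewrite /band_crossings /exit_pos /= oppr0 if_same subrr mulr0.
Qed.

(** Of the two opposite black corners at a crossing exactly one is not outgoing, and the product of
    flows is the same at both. So the flat copy gets the same correction as the twisted bands. *)
Lemma sum_inward (a b : U) : graph_chain xi a -> graph_chain xi b ->
  \sum_(d | black d && ((if outgoing d then 1 else -1) < 0 :> int)) a d * b d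
  = edge_sum a b.
Proof.
move=> ga gb; rewrite big_mkcondr /= sum_black //; apply: eq_bigr => c _.
rewrite !(outgoing_across, graph_across xi_checkerboard _ ga,
  graph_across xi_checkerboard _ gb) mulrNN.
by case: outgoing; rewrite /= ?addr0 ?add0r.
Qed.

Lemma isectE (a b : U) : isect xi a b = vertex_sum a b + edge_sum a b.
Proof. by []. Qed.

(** A band contributes 2 - 1 or 0 - 1, which is its incidence number. *)
Lemma edge_sum_over (a b : U) :
  2 * \sum_(c | is_crossing c && (over_dart (at_c c) == true)) a (at_c c) * b
    (at_c c)
    - edge_sum a b = band_form xi a b.
Proof.
rewrite big_mkcondr mulr_sumr -sumrB; apply: eq_bigr => c _.
by rewrite /Defs.eta; case: over_dart => /=; ring.
Qed.

(** Subtracting the intersection number once from the two lifts leaves: [I] for [upper x] with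
    [lower y], where both lifts are above; [- I] for [lower x] with [upper y], where none is; 0 for
    the lower sheets, where one is. For the upper sheets the disk terms cancel too, and only the
    half twists remain. *)
Lemma GL_pairingE (x y : chain D) :
  graph_chain xi (lower x) -> graph_chain xi (upper y) -> graph_chain xi
    (lower y) ->
  GL_pairing xi x y = band_form xi (upper x) (upper y)
    + isect xi (upper x) (lower y) - isect xi (lower x) (upper y).
Proof.
move=> gx gyu gyl; rewrite /GL_pairing /lk /intersection /cover_bundles
  /core_bundles.
rewrite /shifted_bundles /transfer /= !(big_cons, big_nil) /band_over /=.
rewrite !disk_crossings_core //= !sum_band_twisted !sum_band_straight
  !sum_inward //.
rewrite !sum_and_const /=.
by rewrite ltr01 -edge_sum_over !isectE /edge_sum; ring.
Qed.

(** All strands have level 0, so only bands count. In each band the link passes over one of the two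
    strands of the push-off, and its own two strands contribute equally for type II and cancel for
    type I. *)
Lemma euler_number_mu : euler_number xi = - (2 * mu xi).
Proof.
rewrite /euler_number /lk /link_bundles /= !(big_cons,
  big_nil) /= !add0r !addr0.
congr (- _); rewrite /mu !big_mkcondr /= mulr_sumr -!big_split /=;
  apply: eq_bigr => c _.
rewrite /band_over /band_crossings /exit_pos /type_II /Defs.eta /=
  black_black_at //.
rewrite (_ : (3 < 2 :> int) = false) // (_ : (3 < -2 :> int) = false) //.
rewrite (_ : (-3 < 2 :> int) = true) // (_ : (-3 < -2 :> int) = true) //.
case: (outgoing c) => //.
by case: (over_dart _); case: (outgoing (at_c c)); case: (outgoing (turn _)).
Qed.

End Pairing.

(** * The first homology of F' as a double *)

Section Homology.
Variables (D : diagram) (xi : pred (region D)).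
Hypothesis xi_checkerboard : checkerboard xi.
Variables (b0 w0 : region D) (b0_black : xi b0).

Definition sheets (x : chain D) := (upper x, lower x).

(** The coefficient of the tube edge is the total flow of the upper chain out of all black regions,
    and the two ends of each band cancel. *)
Lemma is_cycleP x : is_cycle xi b0 x <->
  double_cycle (black_cycle xi) (sheets x) /\ tube_edge x = 0.
Proof.
split=> [[gu gl su]|[[[gu su] [gl sl]] t0]]; last first.
  split=> // b xb; have := su b xb; have := sl b xb; rewrite /= t0 => -> ->.
  by rewrite if_same !oppr0 !addr0.
have t0 : tube_edge x = 0.
  transitivity (\sum_(d | black_corner xi d) upper x d).
    rewrite (partition_big (@reg D) xi) //= (bigD1 b0) //=.
    rewrite (eq_bigl (fun d => reg d == b0)) => [|d]; last first.
      by rewrite /black_corner; case: eqP => [->|]; rewrite ?b0_black ?andbF.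
    have [/eqP] := su b0 b0_black; rewrite eqxx [X in X == 0]addrC subr_eq0 =>
      /eqP <- _.
    rewrite big1 ?addr0 // => b /andP[xb bb0].
    rewrite (eq_bigl (fun d => reg d == b)) => [|d]; last first.
      by rewrite /black_corner; case: eqP => [->|]; rewrite ?xb ?andbF.
    by have [/eqP] := su b xb; rewrite (negPf bb0) addr0 oppr_eq0 => /eqP.
  rewrite sum_black //; apply: big1 => c _.
  by rewrite (graph_across xi_checkerboard _ gu) subrr.
by split=> //; split; split=> // b /su[];
  rewrite t0 if_same ?addr0 ?subr0 => /eqP;
  rewrite oppr_eq0 => /eqP ? /eqP; rewrite oppr_eq0 => /eqP.
Qed.

Lemma sheets_morph : zmod_morphism sheets. Proof. by []. Qed.

Lemma sheets_lin m (z : 'I_m -> chain D) k :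
  sheets (lin z k) = lin (fun i => sheets (z i)) k.
Proof. exact: (lin_morph _ _ sheets_morph). Qed.

(* The constants added to y leave its boundary on the black graph unchanged, so
   they absorb the loops of the tube. *)
Lemma boundaryP x : tube_edge x = 0 ->
  (exists y s, x = boundary xi w0 y s) <-> double_boundary (is_boundary xi)
    (sheets x).
Proof.
case: x => [[[[a l] t] u] v]; rewrite /tube_edge /= => ->;
  split=> [[y [s [-> -> _ _]]]|].
  by split=> //; exists y.
rewrite /sheets /upper /lower; case=> /= -> [y ->];
  exists (fun r => y r + (u + v - y w0)), u.
congr (_, _, _, _, _); last by ring.
by apply/ffunP => d; rewrite !ffunE; case: ifP => _; ring.
Qed.

(** The loop coefficients can be forgotten, since [boundaryP] detects boundaries on the two sheets;
    a pair of cycles is lifted with zero loops. *)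
Lemma H1_basis_double m (z : 'I_m -> chain D) : H1_basis xi b0 w0 z ->
  basis_mod (double_cycle (black_cycle xi)) (double_boundary (is_boundary xi))
    (fun i => sheets (z i)).
Proof.
case=> Zz zP; split=> [i|[a l] cal]; first by have /is_cycleP[] := Zz i.
pose x : chain D := (a, l, 0, 0, 0).
have cx : is_cycle xi b0 x by apply/is_cycleP.
have equiv k : (exists y s, x - lin z k = boundary xi w0 y s) <->
    double_boundary (is_boundary xi) ((a, l) - lin (fun i => sheets (z i)) k).
  rewrite boundaryP ?sheets_morph ?sheets_lin //.
  have tB : zmod_morphism (@tube_edge D) by [].
  rewrite tB (lin_morph _ _ tB) big1 ?subr0 // => i _.
  by have /is_cycleP[_ ->] := Zz i; rewrite mul0rz.
have [k [/equiv Bk uniq_k]] := zP x cx.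
by exists k; split=> // k' /equiv; exact: uniq_k.
Qed.

End Homology.

Theorem theorem5p4 (D : diagram) (xi : pred (region D))
    (xi_checkerboard : checkerboard xi)
    (n : nat) (X : 'I_n.+1 -> region D) (X_white : white_enum xi X)
    (b0 w0 : region D) (b0_black : xi b0) (w0_white : ~~ xi w0)
    (b0_w0 : share_edge b0 w0)
    (m : nat) (z : 'I_m -> chain D) (z_basis : H1_basis xi b0 w0 z) :
  [/\ surface_signature xi z = (goeritz_signature xi X)%:~R,
      surface_det xi z = goeritz_det xi X &
      surface_nullity xi z = goeritz_nullity xi X].
Proof.
have bz := H1_basis_double xi_checkerboard b0_black z_basis.
have graph_z i : graph_chain xi (upper (z i)) /\ graph_chain xi (lower (z i)).
  by have [] := bz.1 i => -[gu _] [gl _].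
have GL_gram : GL_matrix xi z =
    gram (double_form (band_form xi) (isect xi)) (fun i => sheets (z i)).
  apply/matrixP => i j; rewrite !mxE GL_pairingE //;
    by [case: (graph_z i)|case: (graph_z j)].
(* The coordinates on all chains serve to extend functionals in the proof that the intersection form
   is unimodular. *)
have [r [e [coord [Ze coordB coordK]]]] := black_cycle_split xi.
have := double_form_invariants (subgroup_black_cycle xi) (subgroup_boundary xi)
  (boundary_cycle xi_checkerboard) (@band_form_morph D xi) (@band_formC D xi)
  (@isect_morph_r D xi) (@isect_morph_l D xi) (isect_skew xi_checkerboard)
  (isect_boundary xi_checkerboard) Ze coordB coordK (poincare_duality
    xi_checkerboard)
  (white_cell_basis xi_checkerboard b0_black X_white) bz.
rewrite -GL_gram (band_form_goeritz xi_checkerboard X_white) =>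
  -[sigE detE nulE].
split=> //; rewrite /surface_signature /goeritz_signature sigE euler_number_mu
  //.
by rewrite [RHS]rmorphB mulrNz rmorphM mulrN mulrA mulVf ?mul1r.
Qed.
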